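(* Let $X\subset P^N(\mathbf{C})$ be a submanifold of dimension $n$ with degenerate Gauss map of rank $r$ ($2\le r<n$), with plane generators $L$ of dimension $l=n-r$, satisfying the standing assumptions of the context. Let $m$ be the number of linearly independent second fundamental forms of $X$. Suppose that $m\ge 2$, and that (for all values of the parameters $u\in M$) the focus hypercones $\Phi_L$ do not have multiple components and are indecomposable. Then $X$ is a cone with an $(l-1)$-dimensional vertex and $l$-dimensional plane generators.
   Context: Setting. $X\subset P^N(\mathbf{C})$ is a smooth $n$-dimensional submanifold whose Gauss map $\gamma:X\to G(n,N)$, $\gamma(x)=T_x(X)$ (the tangent subspace, an $n$-dimensional projective subspace), has constant rank $r<n$; $r$ is called the rank of $X$. The leaves of $\gamma$ are (open parts of) projective subspaces $L$ of dimension $l=n-r$. They are extended to full projective subspaces $P^l$, also denoted $L$ and called plane generators of $X$, so that $X=f(P^l\times M^r)$, with $M$ an $r$-dimensional parameter variety with parameters $u=(u^p)$ and $f:P^l\times M\to P^N$ differentiable. $T_L\supset L$ denotes the $n$-dimensional tangent subspace, constant along $L$. Frames and matrices. Index ranges: $i,j=0,\dots,l$; $p,q,s=l+1,\dots,n$; $\alpha=n+1,\dots,N$. Take projective frames $\{A_0,\dots,A_N\}$ with $A_i\in L$ and $A_i,A_p\in T_L$, and write $dA_a=\sum_b\omega_a^bA_b$ for $a,b=0,\dots,N$. Let $\theta^p$ be basis 1-forms on $M$. Then (summation over repeated indices) $\omega_i^\alpha=0$, $\omega_i^p=c^p_{qi}\theta^q$, $\omega_p^\alpha=b^\alpha_{qp}\theta^q$.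 Put $C_i=(c^p_{qi})$ and $B^\alpha=(b^\alpha_{qp})$, $r\times r$ matrices. They satisfy $b^\alpha_{qs}c^s_{pi}=b^\alpha_{ps}c^s_{qi}$, i.e. the products $H^\alpha_i=B^\alpha C_i=(h^\alpha_{ipq})$ are symmetric, and $h_i^\alpha=h^\alpha_{ipq}\theta^p\theta^q$ are the second fundamental forms of $X$. The osculating subspace $S_L$ of $X$ along $L$ has dimension $n+m$, where $m$ is the number of linearly independent second fundamental forms. Focus hypercone. $\Phi_L$ is the algebraic hypercone of degree $r$ with vertex $T_L$ formed by the hyperplanes $\xi=(\xi_\alpha)\supset T_L$ with $\det(\xi_\alpha B^\alpha)=0$. ''Indecomposable'' means irreducible. Cone. A cone with $(l-1)$-dimensional vertex $S$ (a projective subspace of $P^N$) is a submanifold formed by an $r$-parameter family of $l$-dimensional projective subspaces (its plane generators), all containing $S$. Standing assumptions. $r>1$; for all $u\in M$ the system of forms $h_i^\alpha$ is regular, i.e. among them there is at least one nondegenerate quadratic form; all conditions in theorems are assumed to hold for all $u\in M$. *)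

(* Defs.v *)
From HB Require Import structures.
From mathcomp Require Import all_boot all_order all_algebra.
From mathcomp Require Import all_classical all_reals all_analysis.
From mathcomp Require Import complex.
From mathcomp Require Import -(notations) mpoly.
Set Implicit Arguments.
Unset Strict Implicit.
Unset Printing Implicit Defensive.
Import Order.TTheory GRing.Theory Num.Theory numFieldNormedType.Exports.
Local Open Scope classical_set_scope.
Local Open Scope ring_scope.

(* Derivatives and differentiability are those of normed spaces over the field
   K; for K = R[i] they are complex ones, and a map smooth on an open set is a
   holomorphic map. *)
Definition iter_derive (K : numFieldType) (V W : normedModType K)
    (vs : seq V) (f : V -> W) : V -> W :=
  foldr (fun v g x => 'D_v g x) f vs.

Definition smooth_on (K : numFieldType) (V W : normedModType K)
    (U : set V) (f : V -> W) : Prop :=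
  forall (vs : seq V) (x : V), U x -> differentiable (iter_derive vs f) x.

(* R[i] has no canonical topology of its own: it has to be seen as a
   numFieldType for the topology of R[i]^r to be found. *)
Definition Cspace (R : realType) (r : nat) : normedModType R[i] := 'rV[R[i]]_r.

Record chart (R : realType) (r : nat) (M : topologicalType) := Chart {
  chart_dom : set M;
  chart_cod : set (Cspace R r);
  chart_map :> M -> Cspace R r;
  chart_inv : Cspace R r -> M }.

Definition is_chart (R : realType) (r : nat) (M : topologicalType)
    (c : chart R r M) : Prop :=
  [/\ open (chart_dom c) /\ open (chart_cod c),
      forall u, chart_dom c u -> chart_cod c (c u) /\ chart_inv c (c u) = u,
      forall w, chart_cod c w ->
        chart_dom c (chart_inv c w) /\ c (chart_inv c w) = w,
      {within chart_dom c, continuous c} &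
      {within chart_cod c, continuous (chart_inv c)}].

Record complex_manifold (R : realType) (r : nat) := ComplexManifold {
  mpoints :> topologicalType;
  atlas : set (chart R r mpoints);
  manifold_nonempty : [set: mpoints] !=set0;
  manifold_hausdorff : hausdorff_space mpoints;
  manifold_countable : @second_countable mpoints;
  manifold_connected : connected [set: mpoints];
  atlas_chart : forall c, atlas c -> is_chart c;
  atlas_cover : forall u, exists2 c, atlas c & chart_dom c u;
  atlas_smooth : forall c c', atlas c -> atlas c' ->
    smooth_on (chart_cod c `&` [set w | chart_dom c' (chart_inv c w)])
              (fun w => c' (chart_inv c w)) }.

(* The subspace spanned by the rows 0, ..., k of A. *)
Definition flag (R : realType) (N : nat) (k : nat) (A : 'M[R[i]]_N.+1) :
    {vspace 'rV[R[i]]_N.+1} :=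
  <<[seq row a A | a : 'I_N.+1 <- enum 'I_N.+1 & (a <= k)%N]>>%VS.

(* Projective subspaces of P^N of dimension k are the linear subspaces of
   dimension k.+1 of C^(N+1).  A frame around u0 is a matrix-valued function of
   the local parameters u whose a-th row is (a lift of) the point A_a(u). *)
Record adapted_frame (R : realType) (n r N : nat) (M : complex_manifold R r)
    (L T : M -> {vspace 'rV[R[i]]_N.+1}) (u0 : M) := AdaptedFrame {
  frame_chart : chart R r M;
  frame_dom : set (Cspace R r);
  frame_mx :> Cspace R r -> 'M[R[i]]_N.+1;
  frame_atlas : atlas frame_chart;
  frame_chart_dom : chart_dom frame_chart u0;
  frame_open : open frame_dom;
  frame_sub : frame_dom `<=` chart_cod frame_chart;
  frame_base : frame_dom (frame_chart u0);
  frame_smooth : smooth_on frame_dom frame_mx;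
  frame_unit : forall w, frame_dom w -> frame_mx w \in unitmx;
  frame_generator : forall w, frame_dom w ->
    L (chart_inv frame_chart w) = flag (n - r) (frame_mx w);
  frame_tangent : forall w, frame_dom w ->
    T (chart_inv frame_chart w) = flag n (frame_mx w) }.

Section FrameMatrices.
Variables (R : realType) (n r N : nat) (M : complex_manifold R r).
Variables (L T : M -> {vspace 'rV[R[i]]_N.+1}) (u0 : M).
Variable A : adapted_frame n L T u0.

(* The three ranges of row indices: i = 0, ..., l with l = n - r;
   p = l+1, ..., n; alpha = n+1, ..., N. *)
Definition idx_i (i : 'I_(n - r).+1) : 'I_N.+1 := inord i.
Definition idx_p (p : 'I_r) : 'I_N.+1 := inord ((n - r).+1 + p).
Definition idx_alpha (a : 'I_(N - n)) : 'I_N.+1 := inord (n.+1 + a).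

Definition dframe (q : 'I_r) : 'M[R[i]]_N.+1 :=
  'D_(delta_mx 0 q : Cspace R r) (frame_mx A) (frame_chart A u0).

(* The entry (a, b) of [omega q] is the coefficient of theta^q = du^q in the
   form omega_a^b at u0, so that dA_a = sum_b omega_a^b A_b. *)
Definition omega (q : 'I_r) : 'M[R[i]]_N.+1 :=
  dframe q *m invmx (A (frame_chart A u0)).

Definition matC (i : 'I_(n - r).+1) : 'M[R[i]]_r :=
  \matrix_(p < r, q < r) omega q (idx_i i) (idx_p p).

Definition matB (a : 'I_(N - n)) : 'M[R[i]]_r :=
  \matrix_(q < r, p < r) omega q (idx_p p) (idx_alpha a).

Definition second_form (i : 'I_(n - r).+1) (a : 'I_(N - n)) : 'M[R[i]]_r :=
  matB a *m matC i.

(* The span of the values and of the first derivatives at (x, u0) of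
   f(x, u) = sum_i x^i A_i(u). *)
Definition tangent_space (x : 'rV[R[i]]_(n - r).+1) :
    {vspace 'rV[R[i]]_N.+1} :=
  (L u0 + <<[seq (\sum_i x 0 i *: row (idx_i i) (dframe q))%R | q : 'I_r]>>)%VS.

(* The differential of u |-> T u: its q-th row is the linear map from T to
   C^(N+1) / T sending A_a to sum_alpha omega_a^alpha(d/du^q) A_alpha. *)
Definition gauss_differential : 'M[R[i]]_(r, n.+1 * (N - n)) :=
  \matrix_(q < r) mxvec (\matrix_(a < n.+1, b < N - n)
                            omega q (inord a) (idx_alpha b)).

(* The number of linearly independent h^alpha = sum_i x^i h_i^alpha,
   alpha = n+1, ..., N, as families of forms depending linearly on the point x
   of L; since d^2(sum_i x^i A_i) = sum_alpha h^alpha A_alpha modulo T_L, the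
   osculating subspace along L has dimension n plus this number. *)
Definition number_of_forms : nat :=
  (\dim <<[seq [ffun i => second_form i a] | a : 'I_(N - n)]>>)%VS.

(* det (xi_alpha B^alpha), as a polynomial in the coordinates xi_alpha. *)
Definition focus_equation : mpoly (N - n) R[i] :=
  \det (\sum_(a < N - n) (mpolyX R[i] (mnm1 a) *:
          map_mx (@mpolyC (N - n) R[i]) (matB a))).

End FrameMatrices.

(* The family of plane generators L u of X and of the tangent subspaces T u
   along them.  A point of L u at which f is an immersion is one whose
   [tangent_space] has dimension n.+1, hence equals T u. *)
Record degenerate_submanifold (R : realType) (n r N : nat) :=
  DegenerateSubmanifold {
  parameters : complex_manifold R r;
  generator : parameters -> {vspace 'rV[R[i]]_N.+1};
  tangent : parameters -> {vspace 'rV[R[i]]_N.+1};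
  generator_dim : forall u, \dim (generator u) = (n - r).+1;
  tangent_dim : forall u, \dim (tangent u) = n.+1;
  has_frame : forall u, inhabited (adapted_frame n generator tangent u);
  tangent_along : forall u (A : adapted_frame n generator tangent u) x,
    (tangent_space A x <= tangent u)%VS;
  tangent_generic : forall u (A : adapted_frame n generator tangent u),
    exists x, tangent_space A x = tangent u;
  gauss_rank : forall u (A : adapted_frame n generator tangent u),
    \rank (gauss_differential A) = r }.

Definition frame_at (R : realType) (n r N : nat)
    (X : degenerate_submanifold R n r N) (u : parameters X) : Type :=
  adapted_frame n (@generator _ _ _ _ X) (@tangent _ _ _ _ X) u.

(* Whether an individual h_i^alpha is nondegenerate depends on the choice of
   the points A_i in L and on A_alpha; the condition is on the system spanned by
   them, that is, it asks for some choice of frame. *)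
Definition regular_system (R : realType) (n r N : nat)
    (X : degenerate_submanifold R n r N) (u : parameters X) : Prop :=
  exists (A : frame_at u) (i : 'I_(n - r).+1) (a : 'I_(N - n)),
    second_form A i a \in unitmx.

(* Components of the hypersurface F = 0 with their multiplicities: they are the
   irreducible factors of F up to a unit, i.e. a nonzero constant. *)
Section Components.
Variables (R : realType) (k : nat).
Implicit Types F G H Q a b c : mpoly k R[i].

Definition irreducible G : Prop :=
  [/\ G != 0, G \isn't a GRing.unit &
      forall a b, G = a * b -> a \is a GRing.unit \/ b \is a GRing.unit].

Definition component F G : Prop :=
  irreducible G /\ exists Q, F = G * Q.

Definition has_multiple_component F : Prop :=
  exists G, irreducible G /\ exists Q, F = G ^+ 2 * Q.

Definition indecomposable F : Prop :=
  (exists G, component F G) /\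
  forall G H, component F G -> component F H ->
    exists2 c, c \is a GRing.unit & H = c * G.

End Components.

Definition is_cone (R : realType) (n r N : nat)
    (X : degenerate_submanifold R n r N) : Prop :=
  exists S : {vspace 'rV[R[i]]_N.+1},
    \dim S = (n - r)%N /\ forall u : parameters X, (S <= generator u)%VS.

(* Main.v *)
From HB Require Import structures.
Require Import Defs.
From mathcomp Require Import all_boot all_order all_algebra.
From mathcomp Require Import all_classical all_reals all_analysis.
From mathcomp Require Import complex ring zify.
From mathcomp Require Import -(notations) mpoly.
Set Implicit Arguments.
Unset Strict Implicit.
Unset Printing Implicit Defensive.
Import Order.TTheory GRing.Theory Num.Theory numFieldNormedType.Exports.
Local Open Scope classical_set_scope.
Local Open Scope ring_scope.

(** Write [dA_a = sum_b omega_a^b A_b] for a moving frame [A] adapted to the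
    plane generators.  The proof rests on the structure equation
    [d omega = omega wedge omega] ([maurer_cartan]), that is, on the symmetry of
    second derivatives, used twice.

    Since the tangent subspace is constant along a generator, the forms
    [omega_i^alpha] vanish, and the structure equation for them says that the
    products [B^alpha C_i] are symmetric ([second_form_sym]).  At a generic point
    [x] of [L] the matrix [D = sum_i x^i C_i] is invertible
    ([generic_point_unit]).  Fix [i] and an eigenvalue [e] of [D^-1 C_i], and put
    [N = D^-1 C_i - e].  The matrices [H^alpha = B^alpha D] and [H^alpha N] are
    symmetric, so the image and the kernel of [N] are orthogonal for all the
    [H^alpha].  If [N] were nonzero, its image and its kernel would have positive
    complementary dimensions [s] and [r - s], and in bases adapted to them all
    the [H^alpha] would be block triangular with diagonal blocks of sizes [s] and
    [r - s]: the polynomial [det (xi_alpha B^alpha)] would be a product of two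
    nonunits ([pencil_factor]), against the irreducibility of the focus
    hypercone ([indecomposable_reduced_irreducible]).  Hence all the [C_i] are
    multiples of one invertible matrix, and after the choice of an index [k] with
    [C_k] invertible they are [C_i = lam_i C_k] ([matC_proportional]).

    The points [A_i - lam_i A_k] with [i != k] then span a subspace of [L] of
    projective dimension [l - 1], along which [omega^p] vanishes.  The structure
    equation for these forms reads [nu wedge omega_k^p = 0] for every [p], where
    [nu] is the form that measures how the subspace moves inside [L]; the [r >= 2]
    forms [omega_k^p] being independent, [nu = 0] ([vertex_rows_closed]).  So the
    derivatives of the spanning points stay in their span, and the subspace is
    locally constant ([row_space_locally_constant]).  Two such local vertices
    agree where both are defined, for otherwise [L] would be their sum and hence
    locally constant, against [generator_not_constant]; as the parameter manifold
    is connected, one vertex serves all generators. *)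

(** * Complex derivatives along real lines *)

Section ComplexLines.
Variables (R : realType).
Local Notation C := (R[i] : numFieldType).
Variable V : normedModType C.

Lemma ReB (x y : R[i]) : complex.Re (x - y) = complex.Re x - complex.Re y.
Proof. by case: x y => [a b] [c d]. Qed.

(** Re is real-linear and bounded by the norm, so the difference quotients of [f]
    at real increments carry their limit over to the real part. *)
Lemma is_derive_Re (f : V -> C) (a v : V) (t : R) :
  derivable f (a + (t%:C)%C *: v) v ->
  is_derive t (1:R) (fun s : R => complex.Re (f (a + (s%:C)%C *: v)))
     (complex.Re ('D_v f (a + (t%:C)%C *: v))).
Proof.
move=> df.
suff H : (fun h : R => h^-1 *: (complex.Re (f (a + ((h *: (1:R) + t)%:C)%C *: v)) -
   complex.Re (f (a + (t%:C)%C *: v)))) @ 0^' --> complex.Re ('D_v f (a + (t%:C)%C *: v)).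
  by apply: DeriveDef; [apply/cvg_ex; eexists; exact: H | apply/cvg_lim].
apply/cvgrPdist_le => e e0.
have/cvgrPdist_le : h^-1 *: (f (h *: v + (a + (t%:C)%C *: v)) - f (a + (t%:C)%C *: v))
    @[h --> (0:C)^'] --> 'D_v f (a + (t%:C)%C *: v) by exact: df.
move=> /(_ (e%:C)%C); rewrite ltcR => /(_ e0) [d /= d0 Hd].
have dE : d = ((complex.Re d)%:C)%C by rewrite RRe_real // gtr0_real.
exists (complex.Re d) => /=; first by move: d0; rewrite {1}dE ltcR.
move=> h; rewrite /= sub0r normrN => hd h0.
have := Hd (h%:C)%C; rewrite /= sub0r normrN.
have -> : (`|(h%:C)%C| : C) = (`|h|%:C)%C by rewrite normc_def /= expr0n /= addr0 sqrtr_sqr.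
rewrite {1}dE ltcR => /(_ hd).
have -> : (h%:C)%C != 0 :> C by rewrite (_ : (0:C) = (0:R)%:C%C)// (inj_eq (@complexI R)).
move=> /(_ isT) {}Hd.
rewrite -lecR; apply: le_trans Hd; apply: le_trans (normc_ge_Re _).
rewrite lecR le_eqVlt; apply/orP; left; apply/eqP; congr (`|_|).
rewrite ReB; congr (_ - _).
rewrite (_ : h *: 1 = h); last exact: mulr1.
rewrite (_ : a + ((h + t)%:C)%C *: v = (h%:C)%C *: v + (a + (t%:C)%C *: v)); last first.
  by rewrite rmorphD /= scalerDl addrCA.
rewrite -ReB; set z := f _ - f _.
rewrite (_ : (h%:C)%C^-1 *: z = ((h^-1)%:C)%C * z); last by rewrite fmorphV.
by case: z => x y /=; rewrite mul0r subr0.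
Qed.

(** The mean value theorem fails for complex values (the exponential takes
    the same value at [0] and [2 i pi]), but holds for the real part. *)
Lemma MVT_Re (f : V -> C) (a v : V) :
  (forall t : R, 0 <= t <= 1 -> derivable f (a + (t%:C)%C *: v) v) ->
  exists2 t : R, 0 <= t <= 1 &
    complex.Re (f (a + v) - f a) = complex.Re ('D_v f (a + (t%:C)%C *: v)).
Proof.
move=> df.
pose phi (s : R) : R := complex.Re (f (a + (s%:C)%C *: v)).
pose dphi (s : R) : R := complex.Re ('D_v f (a + (s%:C)%C *: v)).
have der t : t \in `[0,1]%R -> is_derive (t : R) (1:R) phi (dphi t).
  by rewrite in_itv => /= /df; exact: is_derive_Re.
have cphi : {within `[0 : R, 1], continuous phi}.
  apply: derivable_within_continuous => t t01.
  by have [] := der t t01.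
have dphi' (t : R) : t \in `]0,1[%R -> is_derive t (1:R) phi (dphi t).
  by move=> t01; apply: der; apply: subset_itv_oo_cc.
have [t] := MVT_segment ler01 dphi' cphi.
rewrite in_itv => /= t01; rewrite subr0 mulr1 => E.
exists t => //; rewrite ReB -/(dphi t) -E /phi.
rewrite (_ : a + (1%:C)%C *: v = a + v) ?scale1r //.
by rewrite (_ : a + (0%:C)%C *: v = a) // scale0r addr0.
Qed.

Lemma Re_mulI_eq0 (z : C) : complex.Re z = 0 -> complex.Re (z * 'i%C) = 0 -> z = 0.
Proof.
case: z => x y /= ->; rewrite mul0r mulr1 sub0r => /eqP.
by rewrite oppr_eq0 => /eqP ->.
Qed.

(** The second difference is the increment of [phi y = f (y + h w) - f y] from
    [x] to [x + h v], so the mean value theorem turns it into [h] times an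
    increment of [g = D_v f] over [h w], which the differentiability of [g] at
    [x] evaluates up to [o(h)]. *)
Lemma second_difference (f g : V -> C) (x v w : V) :
  (\forall y \near x, differentiable f y /\ 'D_v f y = g y) ->
  differentiable g x ->
  forall e : R, 0 < e -> exists2 d : R, 0 < d & forall h : R, 0 < h < d ->
    `|complex.Re (f (x + (h%:C)%C *: v + (h%:C)%C *: w) - f (x + (h%:C)%C *: v)
        - (f (x + (h%:C)%C *: w) - f x)) -
      h ^+ 2 * complex.Re ('D_w g x)| <= h ^+ 2 * e.
Proof.
move=> nf dg e' e'0; pose e : C := (e'%:C)%C.
have e0 : 0 < e by rewrite ltcR.
(* h B exceeds the norms of the two displacements t h v and t h v + h w, and
   the sum of these norms, for t in [0, 1]. *)
pose B : C := `|v| + `|v| + `|w| + 1.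
have B0 : 0 < B by rewrite ltr_wpDl// !addr_ge0.
have [d1 /= d10 Hd1] : exists2 d : C, 0 < d & forall k, `|k| < d ->
    differentiable f (x + k) /\ 'D_v f (x + k) = g (x + k).
  have /nbhs_ballP[d d0 H] := nf; exists d => // k kd; apply: H.
  by rewrite -ball_normE /= opprD addrA subrr sub0r normrN.
have [d2 /= d20 Hd2] : exists2 d : C, 0 < d & forall k, `|k| < d ->
    `|g (x + k) - g x - 'd g x k| <= e / B * `|k|.
  have /eqaddoP H0 := diff_locally dg.
  have {H0} := H0 (e / B); rewrite divr_gt0// => /(_ isT)/nbhs_ballP[d d0 H].
  exists d => // k kd.
  have := H k; rewrite -ball_normE /= sub0r normrN => /(_ kd).
  rewrite !fctE /= [k + x]addrC; congr (`|_| <= _).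
  by rewrite opprD addrA.
have [d d0 Hd] : exists2 d : R, 0 < d & forall h : R, 0 < h < d ->
    (h%:C)%C * B < d1 /\ (h%:C)%C * B < d2.
  have realE (z : C) : 0 < z -> z = ((complex.Re z)%:C)%C.
    by move=> z0; rewrite RRe_real// gtr0_real.
  have q1 : 0 < d1 / B by rewrite divr_gt0.
  have q2 : 0 < d2 / B by rewrite divr_gt0.
  exists (Num.min (complex.Re (d1 / B)) (complex.Re (d2 / B))).
    by rewrite lt_min -!ltcR -!realE// q1 q2.
  move=> h /andP[_]; rewrite lt_min -!ltcR -!realE// !ltr_pdivlMr//.
  by move=> /andP[].
exists d => // h h0d; have [h0 _] := andP h0d; have [h1 h2] := Hd h h0d.
set c := (h%:C)%C in h1 h2 *.
have c0 : 0 < c by rewrite ltcR.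
have nc : `|c| = c by rewrite gtr0_norm.
have t_le (t : R) : 0 <= t <= 1 -> `|(t%:C)%C : C| <= 1.
  by move=> /andP[t0 t1]; rewrite ger0_norm ?lecR.
have nb1 (t : R) : 0 <= t <= 1 -> `|(t%:C)%C *: (c *: v)| <= c * `|v|.
  move=> t01; rewrite !normrZ nc; apply: ler_piMl; last exact: t_le.
  by rewrite mulr_ge0// ltW.
have nb2 (t : R) : 0 <= t <= 1 -> `|(t%:C)%C *: (c *: v) + c *: w| <= c * (`|v| + `|w|).
  move=> t01; rewrite (le_trans (ler_normD _ _))// mulrDr lerD// ?nb1//.
  by rewrite normrZ nc.
have lt1 (t : R) : 0 <= t <= 1 -> `|(t%:C)%C *: (c *: v)| < c * B.
  move=> /nb1/le_lt_trans; apply; rewrite ltr_pM2l// /B -!addrA ltrDl.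
  by rewrite !ltr_wpDl.
have lt2 (t : R) : 0 <= t <= 1 -> `|(t%:C)%C *: (c *: v) + c *: w| < c * B.
  move=> /nb2/le_lt_trans; apply; rewrite ltr_pM2l// /B -!addrA ltr_wpDl//.
  by rewrite addrA ltrDl.
pose phi (y : V) : C := f (y + c *: w) - f y.
have dphi (t : R) : 0 <= t <= 1 ->
  is_derive (x + (t%:C)%C *: (c *: v)) (c *: v) phi
    (c * (g (x + ((t%:C)%C *: (c *: v) + c *: w)) - g (x + (t%:C)%C *: (c *: v)))).
  move=> t01.
  have [df1 g1] := Hd1 _ (lt_trans (lt1 t t01) h1).
  have [df2 g2] := Hd1 _ (lt_trans (lt2 t t01) h1).
  have dcv (y : V) : differentiable f y -> is_derive y (c *: v) f (c * 'D_v f y).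
    move=> dfy; apply: DeriveDef; first exact: diff_derivable.
    by rewrite !deriveE// linearZ.
  rewrite -g1 -g2 mulrBr; apply: is_deriveB; last exact: dcv.
  have := dcv _ df2; rewrite addrA => -[/= D1 D2].
  have E : (fun e : C => e^-1 *: (f (e *: (c *: v) + (x + (t%:C)%C *: (c *: v) + c *: w)) -
                                  f (x + (t%:C)%C *: (c *: v) + c *: w))) =
           (fun e : C => e^-1 *: (f (e *: (c *: v) + (x + (t%:C)%C *: (c *: v)) + c *: w) -
                                  f (x + (t%:C)%C *: (c *: v) + c *: w))).
    by apply/funext => s; rewrite addrA.
  apply: DeriveDef; first by move: D1; rewrite /derivable E.
  by rewrite -D2 /derive E.
have [t t01] := @MVT_Re phi x (c *: v) (fun t t01 => @ex_derive _ _ _ _ _ _ _ (dphi t t01)).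
have [_ ->] := dphi t t01.
rewrite /phi => ->.
have Dw : 'D_w g x = 'd g x w by rewrite deriveE.
set k2 := _ + c *: w; set k1 := _ *: (c *: v).
have ReM (s : R) (z : R[i]) : complex.Re ((s%:C)%C * z) = s * complex.Re z.
  by case: z => a b /=; rewrite mul0r subr0.
rewrite /c ReM -/c expr2 -mulrA -mulrBr -ReM -/c -ReB normrM (gtr0_norm h0).
rewrite -mulrA ler_pM2l// -lecR rmorphM -/c.
apply: le_trans (normc_ge_Re _) _.
have -> : g (x + k2) - g (x + k1) - c * 'D_w g x =
  (g (x + k2) - g x - 'd g x k2) - (g (x + k1) - g x - 'd g x k1).
  rewrite Dw (_ : c * _ = 'd g x (c *: w)); last by rewrite linearZ.
  rewrite (_ : c *: w = k2 - k1); last by rewrite /k2 addrAC subrr add0r.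
  rewrite linearB; ring.
apply: le_trans (ler_normB _ _) _.
apply: (@le_trans _ _ (e / B * `|k2| + e / B * `|k1|)).
  by apply: lerD; apply: Hd2; [exact: lt_trans (lt2 t t01) h2|exact: lt_trans (lt1 t t01) h2].
rewrite -mulrDr [c * e]mulrC -[e in leRHS](divfK (lt0r_neq0 B0)) -[leRHS]mulrA.
rewrite ler_pM2l ?divr_gt0//.
apply: (@le_trans _ _ (c * (`|v| + `|w|) + c * `|v|)).
  by apply: lerD; [exact: nb2|exact: nb1].
rewrite -mulrDr [leRHS]mulrC ler_pM2l// /B.
by rewrite addrAC lerDl.
Qed.

(** The second difference is symmetric in [v] and [w]. *)
Lemma Re_symmetric_derive (f gv gw : V -> C) (x v w : V) :
  (\forall y \near x, [/\ differentiable f y, 'D_v f y = gv y & 'D_w f y = gw y]) ->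
  differentiable gv x -> differentiable gw x ->
  complex.Re ('D_w gv x) = complex.Re ('D_v gw x).
Proof.
move=> nf dv dw; apply/eqP; rewrite -subr_eq0 -normr_le0; apply/ler_addgt0Pr => e e0.
have nv : \forall y \near x, differentiable f y /\ 'D_v f y = gv y.
  by apply: filterS nf => y [].
have nw : \forall y \near x, differentiable f y /\ 'D_w f y = gw y.
  by apply: filterS nf => y [].
rewrite add0r; have e20 : 0 < e / 2 by rewrite divr_gt0.
have [d1 d10 H1] := second_difference w nv dv e20.
have [d2 d20 H2] := second_difference v nw dw e20.
pose h := Num.min d1 d2 / 2.
have m0 : 0 < Num.min d1 d2 by rewrite lt_min d10.
have h0 : 0 < h by rewrite divr_gt0.
have hm : h < Num.min d1 d2 by rewrite ltr_pdivrMr// ltr_pMr// ltr1n.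
have h1 : 0 < h < d1 by rewrite h0; move: hm; rewrite lt_min => /andP[].
have h2 : 0 < h < d2 by rewrite h0; move: hm; rewrite lt_min => /andP[].
have close (D a b : R) : `|D - h ^+ 2 * a| <= h ^+ 2 * (e / 2) ->
    `|D - h ^+ 2 * b| <= h ^+ 2 * (e / 2) -> `|a - b| <= e.
  move=> Ha Hb.
  have : `|h ^+ 2 * (a - b)| <= h ^+ 2 * e.
    rewrite [e]splitr [leRHS]mulrDr; apply: le_trans (lerD Hb Ha).
    apply: le_trans (ler_normB _ _); rewrite le_eqVlt; apply/orP; left; apply/eqP.
    by congr (`|_|); ring.
  by rewrite normrM gtr0_norm ?exprn_gt0// ler_pM2l ?exprn_gt0.
have := H2 h h2; set c := (h%:C)%C.
rewrite [x + c *: w + c *: v]addrAC.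
have -> : f (x + c *: v + c *: w) - f (x + c *: w) - (f (x + c *: v) - f x) =
  f (x + c *: v + c *: w) - f (x + c *: v) - (f (x + c *: w) - f x) by ring.
exact: close (H1 h h1).
Qed.

(** The imaginary part is controlled by applying the real statement to [i f].
    The derivatives enter through functions [gv] and [gw] equal to them near [x]
    only: an entry of the derivative of a matrix field is the derivative of the
    entry only at points of differentiability. *)
Lemma symmetric_derive (f gv gw : V -> C) (x v w : V) :
  (\forall y \near x, [/\ differentiable f y, 'D_v f y = gv y & 'D_w f y = gw y]) ->
  differentiable gv x -> differentiable gw x ->
  'D_w gv x = 'D_v gw x.
Proof.
move=> nf dv dw.
have RE := Re_symmetric_derive nf dv dw.
pose i : C := 'i%C.
have nif : \forall y \near x, [/\ differentiable (i *: f) y,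
    'D_v (i *: f) y = (i *: gv) y & 'D_w (i *: f) y = (i *: gw) y].
  apply: filterS nf => y [fy vy wy]; split; first exact: differentiableZ.
  - by rewrite deriveZ ?vy//; exact: diff_derivable.
  - by rewrite deriveZ ?wy//; exact: diff_derivable.
have IE := Re_symmetric_derive nif (differentiableZ i dv) (differentiableZ i dw).
rewrite (deriveZ i (diff_derivable dv)) (deriveZ i (diff_derivable dw)) in IE.
move: RE IE; move: ('D_w gv x) => a; move: ('D_v gw x) => b RE IE.
apply/eqP; rewrite -subr_eq0; apply/eqP/Re_mulI_eq0; first by rewrite ReB RE subrr.
by rewrite mulrC mulrBr ReB IE subrr.
Qed.

Lemma derive0_constant (f : V -> C) (x : V) (d : C) :
  (forall y, `|y - x| < d -> forall v, is_derive y v f 0) ->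
  forall y, `|y - x| < d -> f y = f x.
Proof.
move=> df y yd.
have der (g : V -> C) : (forall z, `|z - x| < d -> forall v, is_derive z v g 0) ->
    complex.Re (g y - g x) = 0.
  move=> dg.
  have seg (t : R) : 0 <= t <= 1 -> `|x + (t%:C)%C *: (y - x) - x| < d.
    move=> /andP[t0 t1]; rewrite addrAC subrr add0r normrZ; apply: le_lt_trans yd.
    by apply: ler_piMl => //; rewrite ger0_norm ?lecR.
  have [t t01] := @MVT_Re g x (y - x) (fun t t01 => @ex_derive _ _ _ _ _ _ _ (dg _ (seg t t01) _)).
  have [_ ->] := dg _ (seg t t01) (y - x).
  by rewrite [x + _]addrC subrK => ->.
apply/eqP; rewrite -subr_eq0; apply/eqP/Re_mulI_eq0; first exact: der.
pose i : C := 'i%C.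
have := der (i *: f); rewrite /= !fctE mulrC -/i mulrBr; apply => z zd v.
by have dz := df z zd v; apply: is_derive_eq; rewrite scaler0.
Qed.
End ComplexLines.

(** * Pencils of symmetric matrices *)

Lemma det_ursubmx0 (A : comNzRingType) s t (Y : 'M[A]_(s + t)) :
  ursubmx Y = 0 -> \det Y = \det (ulsubmx Y) * \det (drsubmx Y).
Proof. by move=> Y0; rewrite -[in LHS](submxK Y) Y0 det_lblock. Qed.

Section Pencil.
Variables (F : fieldType) (k : nat).
(** For [B = matB A] the determinant of the pencil is [focus_equation A], by
    definition. *)
Definition pencil r (B : 'I_k -> 'M[F]_r) : 'M[mpoly k F]_r :=
  \sum_(a < k) (mpolyX F (mnm1 a) *: map_mx (@mpolyC k F) (B a)).

Lemma pencil_mulmxr r (B : 'I_k -> 'M[F]_r) (G : 'M[F]_r) :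
  pencil (fun a => B a *m G) = pencil B *m map_mx (@mpolyC k F) G.
Proof. by rewrite mulmx_suml; apply: eq_bigr => a _; rewrite -scalemxAl map_mxM. Qed.

Lemma pencil_mulmxl r (B : 'I_k -> 'M[F]_r) (G : 'M[F]_r) :
  pencil (fun a => G *m B a) = map_mx (@mpolyC k F) G *m pencil B.
Proof. by rewrite mulmx_sumr; apply: eq_bigr => a _; rewrite -scalemxAr map_mxM. Qed.

Lemma unit_mpolyC (c : F) : c != 0 -> mpolyC k c \is a GRing.unit.
Proof. by move=> c0; rewrite rmorph_unit// unitfE. Qed.

Lemma meval0_pencil r (B : 'I_k -> 'M[F]_r) :
  map_mx (meval (fun=> 0)) (pencil B) = 0.
Proof.
rewrite /pencil raddf_sum big1// => a _; apply/matrixP => i j.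
by rewrite !mxE /= rmorphM /= mevalXU mul0r.
Qed.

(** The value at the origin of such a determinant is the determinant of the zero
    matrix, whereas a unit has a nonzero value everywhere. *)
Lemma det_vanish_nonunit r (Y : 'M[mpoly k F]_r) :
  (0 < r)%N -> map_mx (meval (fun=> 0)) Y = 0 -> \det Y \isn't a GRing.unit.
Proof.
move=> r0 Y0; apply/negP => /(rmorph_unit (meval (fun=> 0))).
by rewrite -det_map_mx Y0 -(prednK r0) det0 unitr0.
Qed.

(** For [N = E J G] with [E], [G] invertible and [J] the projector on the first
    [s] coordinates, the symmetry of [B N] says that [Y = E^T B G^-1] satisfies
    [Y^T J = J Y]; the upper right block of the right-hand side must then vanish.
    In invariant terms, the image of [N] is orthogonal to its kernel. *)
Lemma pencil_factor_block s t (B : 'I_k -> 'M[F]_(s + t)) (N : 'M[F]_(s + t)) :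
  (forall a, (B a)^T = B a) -> (forall a, (B a *m N)^T = B a *m N) ->
  \rank N = s -> (0 < s)%N -> (0 < t)%N ->
  exists F1 F2 : mpoly k F, [/\ \det (pencil B) = F1 * F2,
     F1 \isn't a GRing.unit & F2 \isn't a GRing.unit].
Proof.
move=> symB symBN rkN s0 t0.
pose E := col_ebase N; pose G := row_ebase N.
have Eu : E \in unitmx by exact: col_ebase_unit.
have Gu : G \in unitmx by exact: row_ebase_unit.
have NE : N = E *m pid_mx s *m G by rewrite -[LHS]mulmx_ebase rkN.
pose Y a := E^T *m B a *m invmx G.
have Y_ur a : ursubmx (Y a) = 0.
  have H : (Y a)^T *m pid_mx s = pid_mx s *m Y a.
    rewrite /Y !trmx_mul trmxK symB trmx_inv.
    have GT : G^T \in unitmx by rewrite unitmx_tr.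
    rewrite -[LHS](mulKmx GT) -[RHS](mulKmx GT); congr (_ *m _).
    rewrite -[LHS](mulmxK Gu) -[RHS](mulmxK Gu); congr (_ *m _).
    rewrite !mulmxA mulmxV// mul1mx -[RHS]mulmxA mulVmx// mulmx1.
    transitivity (B a *m N); first by rewrite NE !mulmxA.
    by rewrite -symBN NE !trmx_mul tr_pid_mx symB !mulmxA.
  move: H; rewrite -{1 2}[Y a]submxK pid_mx_block tr_block_mx !mulmx_block.
  by rewrite !(mul1mx, mulmx1, mul0mx, mulmx0, addr0, add0r) => /eq_block_mx[_ <-].
have Pur : ursubmx (pencil Y) = 0.
  apply/matrixP => i j; rewrite !mxE summxE big1// => a _.
  by have /matrixP/(_ i j) := Y_ur a; rewrite !mxE => ->; rewrite mpolyC0 mulr0.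
have PE : pencil Y = map_mx (@mpolyC k F) E^T *m pencil B *m map_mx (@mpolyC k F) (invmx G).
  by rewrite -pencil_mulmxl -pencil_mulmxr.
(* The congruence by E and G changes the determinant by the constants d1 and
   d2, absorbed into the two factors. *)
have := det_ursubmx0 Pur; rewrite [in LHS]PE 2!det_mulmx !det_map_mx /=.
set d1 := mpolyC _ _; set d2 := mpolyC _ _ => dE.
have d1u : d1 \is a GRing.unit by rewrite unit_mpolyC// det_tr -unitfE -unitmxE.
have d2u : d2 \is a GRing.unit by rewrite unit_mpolyC// -unitfE -unitmxE unitmx_inv.
exists (d1^-1 * \det (ulsubmx (pencil Y))), (d2^-1 * \det (drsubmx (pencil Y))).
split.
- by rewrite mulrACA -dE (mulrAC d1) mulrA mulrACA mulVr// mulVr// !mul1r.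
- rewrite unitrM unitrV d1u; apply: det_vanish_nonunit => //.
  by rewrite map_ulsubmx meval0_pencil; apply/matrixP => i j; rewrite !mxE.
- rewrite unitrM unitrV d2u; apply: det_vanish_nonunit => //.
  by rewrite map_drsubmx meval0_pencil; apply/matrixP => i j; rewrite !mxE.
Qed.

Lemma pencil_factor r (B : 'I_k -> 'M[F]_r) (N : 'M[F]_r) :
  (forall a, (B a)^T = B a) -> (forall a, (B a *m N)^T = B a *m N) ->
  N != 0 -> N \notin unitmx ->
  exists F1 F2 : mpoly k F, [/\ \det (pencil B) = F1 * F2,
     F1 \isn't a GRing.unit & F2 \isn't a GRing.unit].
Proof.
move=> symB symBN N0 Nu.
have s0 : (0 < \rank N)%N by rewrite lt0n mxrank_eq0.
have sr : (\rank N < r)%N.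
  by rewrite ltn_neqAle rank_leq_row andbT; move: Nu; rewrite -row_free_unit.
have [t t0 rE] : exists2 t, (0 < t)%N & r = (\rank N + t)%N.
  by exists (r - \rank N)%N; rewrite ?subn_gt0 ?subnKC// ltnW.
move: rE s0; have : \rank N = \rank N by []; move: {-1}(\rank N) => s rk rE s0.
clear sr Nu N0; subst r.
exact: pencil_factor_block symBN rk s0 t0.
Qed.
End Pencil.

Section Components.
Variables (R : realType) (k : nat).
Local Notation P := (mpoly k R[i]).

Lemma msize_nonunit (a : P) : a != 0 -> a \isn't a GRing.unit -> (1 < msize a)%N.
Proof.
move=> a0; apply: contraR; rewrite -leqNgt => /msize1_polyC aE.
rewrite aE unit_mpolyC//; apply: contra_neq a0 => c0.
by rewrite aE c0 mpolyC0.
Qed.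

(** A nonunit that is not irreducible has a proper factor of smaller degree. *)
Lemma exists_component (F : P) : F != 0 -> F \isn't a GRing.unit ->
  exists G, component F G.
Proof.
have [s] := ubnP (msize F); elim: s F => // s IH F sF F0 Fu.
have [irrF|nirr] := pselect (irreducible F).
  by exists F; split => //; exists 1; rewrite mulr1.
have [a [b [FE au bu]]] : exists a b,
    [/\ F = a * b, a \isn't a GRing.unit & b \isn't a GRing.unit].
  apply: contrapT => H; apply: nirr; split=> // a b FE.
  have [?|au] := boolP (a \is a GRing.unit); first by left.
  have [?|bu] := boolP (b \is a GRing.unit); first by right.
  by case: H; exists a, b.
move: F0; rewrite FE mulf_eq0 negb_or => /andP[a0 b0].
have [|G [irrG [Q aE]]] := IH a _ a0 au.
  move: sF; rewrite FE msizeM//; have := msize_nonunit b0 bu.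
  case: (msize b) => // -[] // m _; rewrite addnS /= ltnS addnS => h.
  by apply: leq_ltn_trans h; exact: leq_addr.
by exists G; split => //; exists (Q * b); rewrite mulrA -aE.
Qed.

(** Irreducible factors of [F1] and [F2] are associate, so that their product
    would give a multiple component.  The hypotheses exclude [F = 0] as well,
    because every square divides [0]. *)
Lemma indecomposable_reduced_irreducible (F F1 F2 : P) :
  indecomposable F -> ~ has_multiple_component F -> F = F1 * F2 ->
  F1 \is a GRing.unit \/ F2 \is a GRing.unit.
Proof.
move=> [[G0 [irr0 _]] uniF] mulF FE.
have F0 : F != 0.
  by apply/eqP => F0; apply: mulF; exists G0; split => //; exists 0; rewrite mulr0.
move: F0; rewrite FE mulf_eq0 negb_or => /andP[F10 F20].
have [?|F1u] := boolP (F1 \is a GRing.unit); first by left.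
have [?|F2u] := boolP (F2 \is a GRing.unit); first by right.
have [G1 [irr1 [Q1 F1E]]] := exists_component F10 F1u.
have [G2 [irr2 [Q2 F2E]]] := exists_component F20 F2u.
have [||c _ G2E] := uniF G1 G2.
- by split=> //; exists (Q1 * F2); rewrite FE F1E mulrA.
- by split=> //; exists (Q2 * F1); rewrite FE F2E mulrCA [F1 * Q2]mulrC.
case: mulF; exists G1; split => //; exists (Q1 * c * Q2).
by rewrite FE F1E F2E G2E; ring.
Qed.

(** [D^-1 C - l] is singular for an eigenvalue [l], and it would factor the
    determinant of the pencil if it were nonzero. *)
Lemma irreducible_pencil_proportional r (B : 'I_k -> 'M[R[i]]_r) (D C : 'M[R[i]]_r) :
  (0 < r)%N -> indecomposable (\det (pencil B)) ->
  ~ has_multiple_component (\det (pencil B)) ->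
  D \in unitmx -> (forall a, (B a *m D)^T = B a *m D) ->
  (forall a, (B a *m C)^T = B a *m C) -> exists l, C = l *: D.
Proof.
move=> r0 ind mult Du symD symC.
have [l] : exists l, root (char_poly (invmx D *m C)) l.
  by apply: (elimT (closed_rootP _)); rewrite size_char_poly eqSS -lt0n.
rewrite -eigenvalue_root_char => eigl.
pose N := invmx D *m C - l%:M.
have Nu : N \notin unitmx.
  move: eigl; rewrite /eigenvalue /eigenspace -/N kermx_eq0.
  by rewrite row_free_unit.
have [N0|N0] := eqVneq N 0.
  exists l; rewrite -mul_mx_scalar -(mulKVmx Du C); congr (_ *m _).
  by apply/eqP; rewrite -subr_eq0 -/N N0.
have symN a : (B a *m D *m N)^T = B a *m D *m N.
  rewrite mulmxBr mulmxA mulmxK// mul_mx_scalar.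
  by rewrite [LHS]linearB /= [X in _ - X = _]linearZ /= symC symD.
have [F1 [F2 [E F1u F2u]]] := pencil_factor symD symN N0 Nu.
move: E; rewrite pencil_mulmxr det_mulmx det_map_mx /= => E.
have du : mpolyC k (\det D) \is a GRing.unit by rewrite unit_mpolyC// -unitfE -unitmxE.
have [] := indecomposable_reduced_irreducible
  (F1 := F1) (F2 := F2 * (mpolyC k (\det D))^-1) ind mult.
- by rewrite mulrA -E mulrK.
- by rewrite (negbTE F1u).
- by rewrite unitrM (negbTE F2u).
Qed.
End Components.

(** * Entrywise differential calculus of matrix fields *)

Section MatrixCalculus.
Variables (K : numFieldType) (V : normedModType K).

Definition mx_differentiable m n (M : V -> 'M[K]_(m, n)) (x : V) :=
  forall i j, differentiable (fun y => M y i j : K) x.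

Definition derive_mx m n (v : V) (M : V -> 'M[K]_(m, n)) (x : V) : 'M[K]_(m, n) :=
  \matrix_(i, j) 'D_v (fun y => M y i j : K) x.

Lemma differentiable_entries m n (M : V -> 'M[K]_(m, n)) x :
  differentiable M x -> mx_differentiable M x.
Proof.
move=> dM i j; apply: (@differentiable_comp _ _ _ _ M (fun N : 'M[K]_(m, n) => N i j : K)) => //.
exact: differentiable_coord.
Qed.

Lemma derive_linear (W W' : normedModType K) (f : {linear W -> W'}) (M : V -> W) x v :
  continuous f -> differentiable M x -> 'D_v (f \o M) x = f ('D_v M x).
Proof.
move=> cf dM; have df : differentiable f (M x) by exact: linear_differentiable.
by rewrite !deriveE//; [rewrite diff_comp//= diff_lin|exact: differentiable_comp].
Qed.

Lemma derive_entries m n (M : V -> 'M[K]_(m, n)) x v :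
  differentiable M x -> 'D_v M x = derive_mx v M x.
Proof.
move=> dM; apply/matrixP => i j; rewrite mxE.
have @f : {linear 'M[K]_(m, n) -> K}.
  by exists (fun N : 'M[K]_(_, _) => N i j); do 2![eexists]; do ?[constructor];
     rewrite ?mxE// => ? *; rewrite ?mxE//; move=> ?; rewrite !mxE.
have cf : continuous f by exact: coord_continuous.
by have := derive_linear v cf dM.
Qed.

Lemma eq_derive_mx m n (M P : V -> 'M[K]_(m, n)) x v :
  (\forall y \near x, M y = P y) -> derive_mx v M x = derive_mx v P x.
Proof.
move=> MP; apply/matrixP => i j; rewrite !mxE; apply: near_eq_derive.
by apply: filterS MP => y ->.
Qed.

Lemma differentiable_big_sum (I : Type) (s : seq I) (f : I -> V -> K) x :
  (forall i, differentiable (f i) x) -> differentiable (fun y => \sum_(i <- s) f i y) x.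
Proof.
move=> df; elim: s => [|i s IH].
  by under eq_fun do rewrite big_nil; exact: differentiable_cst.
by under eq_fun do rewrite big_cons; exact: differentiableD.
Qed.

Lemma derive_big_sum (I : Type) (s : seq I) (f : I -> V -> K) x v :
  (forall i, differentiable (f i) x) ->
  'D_v (fun y => \sum_(i <- s) f i y) x = \sum_(i <- s) 'D_v (f i) x.
Proof.
move=> df; elim: s => [|i s IH].
  by under eq_fun do rewrite big_nil; rewrite big_nil; exact: derive_cst.
under eq_fun do rewrite big_cons; rewrite big_cons -IH; apply: deriveD.
  exact: diff_derivable.
by apply: diff_derivable; exact: differentiable_big_sum.
Qed.

Lemma differentiable_big_prod (I : Type) (s : seq I) (f : I -> V -> K) x :
  (forall i, differentiable (f i) x) -> differentiable (fun y => \prod_(i <- s) f i y) x.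
Proof.
move=> df; elim: s => [|i s IH].
  by under eq_fun do rewrite big_nil; exact: differentiable_cst.
by under eq_fun do rewrite big_cons; exact: differentiableM.
Qed.

Lemma mx_differentiable_cst m n (A : 'M[K]_(m, n)) x : mx_differentiable (fun=> A) x.
Proof. by move=> i j; exact: differentiable_cst. Qed.

Lemma derive_mx_cst m n (A : 'M[K]_(m, n)) x v : derive_mx v (fun=> A) x = 0.
Proof. by apply/matrixP => i j; rewrite !mxE derive_cst. Qed.

Lemma mx_differentiable_mul m n p (M : V -> 'M[K]_(m, n)) (P : V -> 'M[K]_(n, p)) x :
  mx_differentiable M x -> mx_differentiable P x ->
  mx_differentiable (fun y => M y *m P y) x.
Proof.
move=> dM dP i j; under eq_fun do rewrite mxE.
by apply: differentiable_big_sum => k; exact: differentiableM.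
Qed.

Lemma derive_mx_mul m n p (M : V -> 'M[K]_(m, n)) (P : V -> 'M[K]_(n, p)) x v :
  mx_differentiable M x -> mx_differentiable P x ->
  derive_mx v (fun y => M y *m P y) x = derive_mx v M x *m P x + M x *m derive_mx v P x.
Proof.
move=> dM dP; apply/matrixP => i j; rewrite !mxE; under eq_fun do rewrite mxE.
rewrite derive_big_sum; last by move=> k; exact: differentiableM.
rewrite -big_split /=; apply: eq_bigr => k _; rewrite !mxE.
rewrite (deriveM (f := fun y => M y i k : K) (g := fun y => P y k j : K)); [|exact: diff_derivable..].
by rewrite addrC; congr (_ + _); exact: mulrC.
Qed.

Lemma differentiable_det n (M : V -> 'M[K]_n) x :
  mx_differentiable M x -> differentiable (fun y => \det (M y)) x.
Proof.
move=> dM; apply: differentiable_big_sum => s.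
apply: differentiableM; first exact: differentiable_cst.
by apply: differentiable_big_prod.
Qed.

(** Cramer's formula, without the case distinction of [invmx]: its entries are
    differentiable functions of those of the matrix wherever that is invertible. *)
Definition adjinv n (M : 'M[K]_n) : 'M[K]_n := (\det M)^-1 *: \adj M.

Lemma adjinvE n (M : 'M[K]_n) : M \in unitmx -> adjinv M = invmx M.
Proof. by rewrite /invmx => ->. Qed.

Lemma mx_differentiable_adjinv n (M : V -> 'M[K]_n) x :
  mx_differentiable M x -> M x \in unitmx -> mx_differentiable (fun y => adjinv (M y)) x.
Proof.
move=> dM Mu i j; under eq_fun do rewrite !mxE.
apply: differentiableM.
  by apply: differentiableV; [exact: differentiable_det|rewrite -unitfE -unitmxE].
apply: differentiableM; first exact: differentiable_cst.
apply: differentiable_det => i' j'; under eq_fun do rewrite !mxE; exact: dM.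
Qed.

Lemma near_unitmx n (M : V -> 'M[K]_n) x :
  mx_differentiable M x -> M x \in unitmx -> \forall y \near x, M y \in unitmx.
Proof.
move=> dM Mu.
have /differentiable_continuous c := differentiable_det dM.
have d0 : \det (M x) != 0 by rewrite -unitfE -unitmxE.
have c' : (\det (M y) : K) @[y --> x] --> (\det (M x) : K) by exact: c.
have nd : \forall y \near x, (\det (M y) : K) != 0 by exact: (cvgr_neq0 _ c' d0).
by apply: filterS nd => y; rewrite unitmxE unitfE.
Qed.
End MatrixCalculus.

(** * Structure equations and constant row spaces *)

Section ComplexMatrixFields.
Variables (R : realType) (r : nat).
Local Notation C := (R[i] : numFieldType).
Local Notation V := (Cspace R r).

Definition dir (q : 'I_r) : V := delta_mx 0 q.

Lemma is_derive0_dir (f : V -> C) (x : V) :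
  differentiable f x -> (forall q, 'D_(dir q) f x = 0) -> forall v, is_derive x v f 0.
Proof.
move=> df f0 v; apply: DeriveDef; first exact: diff_derivable.
rewrite deriveE// [v]row_sum_delta linear_sum big1// => q _.
by rewrite linearZ /= -deriveE// f0 scaler0.
Qed.

(** Differentiating [D_q A = Om_q A] along [s] gives
    [D_s D_q A = (D_s Om_q + Om_q Om_s) A], whose left-hand side is symmetric in
    [q] and [s]. *)
Lemma maurer_cartan n (A : V -> 'M[C]_n) (Om : 'I_r -> V -> 'M[C]_n) (x : V) (q s : 'I_r) :
  (\forall y \near x, differentiable A y /\ forall p, 'D_(dir p) A y = Om p y *m A y) ->
  (forall p, differentiable ('D_(dir p) A) x) ->
  (forall p, mx_differentiable (Om p) x) -> A x \in unitmx ->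
  derive_mx (dir s) (Om q) x + Om q x *m Om s x =
  derive_mx (dir q) (Om s) x + Om s x *m Om q x.
Proof.
move=> nA dAq dOm Au.
have [dA AqE] := nbhs_singleton nA.
have DD p t : derive_mx (dir p) ('D_(dir t) A) x =
    (derive_mx (dir p) (Om t) x + Om t x *m Om p x) *m A x.
  rewrite (@eq_derive_mx _ _ _ _ _ (fun y => Om t y *m A y)); last first.
    by apply: filterS nA => y [_ ->].
  rewrite derive_mx_mul//; last exact: differentiable_entries.
  by rewrite mulmxDl -mulmxA -AqE derive_entries.
suff : derive_mx (dir s) ('D_(dir q) A) x = derive_mx (dir q) ('D_(dir s) A) x.
  rewrite !DD => /(congr1 (fun N => N *m invmx (A x))).
  by rewrite !mulmxK.
apply/matrixP => i j; rewrite [LHS]mxE [RHS]mxE.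
apply: (@symmetric_derive _ _ (fun y => A y i j)).
- apply: filterS nA => y [dAy _]; split; first exact: differentiable_entries.
  + by rewrite derive_entries ?mxE.
  + by rewrite derive_entries ?mxE.
- by apply: differentiable_entries; exact: dAq.
- by apply: differentiable_entries; exact: dAq.
Qed.

(** The square matrix [M = Y T] satisfies the same equation [dM = mu M] as [Y],
    so [M^-1 Y] has derivative zero. *)
Lemma row_space_locally_constant p n (Y : V -> 'M[C]_(p, n)) (x : V) (T : 'M[C]_(n, p)) :
  Y x *m T = 1%:M ->
  (\forall y \near x, mx_differentiable Y y /\
     forall q, exists mu, derive_mx (dir q) Y y = mu *m Y y) ->
  \forall y \near x, (Y x <= Y y)%MS.
Proof.
move=> YT nY; pose M y := Y y *m T.
have dM y : mx_differentiable Y y -> mx_differentiable M y.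
  by move=> dY; apply: mx_differentiable_mul => //; exact: mx_differentiable_cst.
have Mx1 : M x = 1%:M by [].
have nM : \forall y \near x, M y \in unitmx.
  apply: near_unitmx; last by rewrite Mx1 unitmx1.
  by apply: dM; have [] := nbhs_singleton nY.
pose Z y := adjinv (M y) *m Y y.
have /nbhs_ballP[d d0 Hd] : \forall y \near x, M y \in unitmx /\
    (mx_differentiable Y y /\ forall q, exists mu, derive_mx (dir q) Y y = mu *m Y y).
  by apply: filterS2 nM nY.
have ballE y : `|y - x| < d -> ball x d y.
  by rewrite -ball_normE /= distrC.
have nbh y : `|y - x| < d -> \forall z \near y, `|z - x| < d.
  move=> yd; apply: filterS (_ : nbhs y (ball x d)) => [z|].
    by rewrite -ball_normE /= distrC.
  by apply: open_nbhs_nbhs; split; [exact: ball_open|exact: ballE].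
have dZ y : `|y - x| < d -> mx_differentiable Z y.
  move=> yd; have [My [dY _]] := Hd y (ballE y yd).
  by apply: mx_differentiable_mul => //; apply: mx_differentiable_adjinv => //; exact: dM.
have dZ0 y q : `|y - x| < d -> derive_mx (dir q) Z y = 0.
  move=> yd; have [My [dY /(_ q)[mu Emu]]] := Hd y (ballE y yd).
  have YE : \forall z \near y, Y z = M z *m Z z.
    apply: filterS (nbh y yd) => z zd; have [Mz _] := Hd z (ballE z zd).
    by rewrite /Z adjinvE// mulKVmx.
  have DM : derive_mx (dir q) M y = mu *m M y.
    have dT : mx_differentiable (fun _ : V => T) y by exact: mx_differentiable_cst.
    have -> := derive_mx_mul (dir q) dY dT.
    by rewrite derive_mx_cst mulmx0 addr0 Emu -mulmxA.
  have DMZ : derive_mx (dir q) Y y = derive_mx (dir q) M y *m Z y + M y *m derive_mx (dir q) Z y.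
    rewrite (eq_derive_mx (dir q) YE) derive_mx_mul//; [exact: dM|exact: dZ].
  have /(congr1 (fun N => invmx (M y) *m N)) : M y *m derive_mx (dir q) Z y = 0.
    apply: (addrI (derive_mx (dir q) M y *m Z y)).
    by rewrite -DMZ Emu DM addr0 -mulmxA -(nbhs_singleton YE).
  by rewrite mulKmx// mulmx0.
apply: filterS (nbh x _) => [y yd|]; last by rewrite subrr normr0.
have [My _] := Hd y (ballE y yd).
have -> : Y x = Z y.
  have Zx : Z x = Y x.
    by rewrite /Z Mx1 adjinvE ?unitmx1// invmx1 mul1mx.
  rewrite -Zx; apply/matrixP => i j; apply/esym.
  apply: (@derive0_constant _ _ (fun y => Z y i j) x d) => // z zd v.
  apply: is_derive0_dir; first exact: dZ.
  by move=> q; have /matrixP/(_ i j) := dZ0 z q zd; rewrite !mxE.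
exact: submxMl.
Qed.
End ComplexMatrixFields.

(** * Moving frames and flags *)

Section FrameFields.
Variables (R : realType) (n r N : nat) (M : complex_manifold R r).
Variables (L T : M -> {vspace 'rV[R[i]]_N.+1}).
Local Notation C := (R[i] : numFieldType).
Local Notation V := (Cspace R r).
Local Notation frame := (adapted_frame n L T).

Lemma chart_inv_dom (u0 : M) (A : frame u0) w : frame_dom A w ->
  chart_dom (frame_chart A) (chart_inv (frame_chart A) w).
Proof.
by have [_ _ inv _ _] := atlas_chart (frame_atlas A); move=> /frame_sub/inv[].
Qed.

Lemma chart_invK (u0 : M) (A : frame u0) w : frame_dom A w ->
  frame_chart A (chart_inv (frame_chart A) w) = w.
Proof.
by have [_ _ inv _ _] := atlas_chart (frame_atlas A); move=> /frame_sub/inv[].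
Qed.

(** [omega] is evaluated at the base point of a frame only; moving the base point
    along the domain makes every pointwise result about frames hold on the whole
    domain. *)
Definition rebase (u0 : M) (A : frame u0) (w : V) (Aw : frame_dom A w) :
  frame (chart_inv (frame_chart A) w).
Proof.
apply: (@AdaptedFrame R n r N M L T _ (frame_chart A) (frame_dom A) (frame_mx A)).
- exact: frame_atlas.
- exact: chart_inv_dom.
- exact: frame_open.
- exact: frame_sub.
- by rewrite chart_invK.
- exact: frame_smooth.
- exact: frame_unit.
- exact: frame_generator.
- exact: frame_tangent.
Defined.

Definition omega_field (u0 : M) (A : frame u0) (q : 'I_r) (w : V) : 'M[R[i]]_N.+1 :=
  'D_(dir R q) (frame_mx A) w *m adjinv (frame_mx A w).

Lemma omega_rebase (u0 : M) (A : frame u0) (w : V) (Aw : frame_dom A w) q :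
  omega (rebase Aw) q = omega_field A q w.
Proof.
by rewrite /omega /dframe /= chart_invK// /omega_field adjinvE //; exact: frame_unit.
Qed.

Lemma omegaE (u0 : M) (A : frame u0) q : omega A q = omega_field A q (frame_chart A u0).
Proof. by rewrite /omega_field adjinvE //; apply: frame_unit; exact: frame_base. Qed.

Lemma near_frame_dom (u0 : M) (A : frame u0) w : frame_dom A w ->
  \forall w' \near w, frame_dom A w'.
Proof. by move=> Aw; apply: open_nbhs_nbhs; split => //; exact: frame_open. Qed.

Lemma differentiable_frame (u0 : M) (A : frame u0) w : frame_dom A w ->
  differentiable (frame_mx A) w.
Proof. exact: (@frame_smooth _ _ _ _ _ _ _ _ A [::]). Qed.

Lemma differentiable_dframe (u0 : M) (A : frame u0) q w : frame_dom A w ->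
  differentiable ('D_(dir R q) (frame_mx A)) w.
Proof. exact: (@frame_smooth _ _ _ _ _ _ _ _ A [:: dir R q]). Qed.

Lemma derive_frame (u0 : M) (A : frame u0) q w : frame_dom A w ->
  'D_(dir R q) (frame_mx A) w = omega_field A q w *m frame_mx A w.
Proof.
by move=> Aw; rewrite /omega_field adjinvE ?mulmxKV//; exact: frame_unit.
Qed.

Lemma mx_differentiable_omega (u0 : M) (A : frame u0) q w : frame_dom A w ->
  mx_differentiable (omega_field A q) w.
Proof.
move=> Aw; apply: mx_differentiable_mul.
  by apply: differentiable_entries; exact: differentiable_dframe.
apply: mx_differentiable_adjinv; last exact: frame_unit.
by apply: differentiable_entries; exact: differentiable_frame.
Qed.

Lemma omega_integrable (u0 : M) (A : frame u0) q s w : frame_dom A w ->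
  derive_mx (dir R s) (omega_field A q) w + omega_field A q w *m omega_field A s w =
  derive_mx (dir R q) (omega_field A s) w + omega_field A s w *m omega_field A q w.
Proof.
move=> Aw; apply: (maurer_cartan (A := frame_mx A)).
- apply: filterS (near_frame_dom Aw) => y Ay; split; first exact: differentiable_frame.
  by move=> p; exact: derive_frame.
- by move=> p; exact: differentiable_dframe.
- by move=> p; exact: mx_differentiable_omega.
- exact: frame_unit.
Qed.

End FrameFields.

Section Flags.
Variables (R : realType) (N : nat).

Lemma mem_flag k (A : 'M[R[i]]_N.+1) (v : 'rV[R[i]]_N.+1) : A \in unitmx ->
  reflect (forall b : 'I_N.+1, (k < b)%N -> (v *m invmx A) 0 b = 0) (v \in flag k A).
Proof.
move=> Au; apply: (iffP idP) => [vA b kb|vA].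
  pose f : {linear 'rV[R[i]]_N.+1 -> 'rV[R[i]]_1} := mulmxr (invmx A *m (delta_mx b 0 : 'cV_N.+1)).
  have : (flag k A <= lker (linfun f))%VS.
    apply/span_subvP => _ /mapP[a +  ->]; rewrite mem_filter mem_enum => /andP[ak _].
    rewrite memv_ker lfunE /= mulmxA -row_mul mulmxV// -row_mul mul1mx.
    apply/eqP/rowP => j; rewrite !mxE; case: eqP => // ab.
    by move: kb; rewrite -ab ltnNge ak.
  move=> /subvP/(_ v vA); rewrite memv_ker lfunE /= mulmxA => /eqP/rowP/(_ 0).
  rewrite mxE (bigD1 b)//= big1; last by move=> c cb; rewrite !mxE (negbTE cb) mulr0.
  by rewrite !mxE !eqxx mulr1 addr0.
rewrite -(mulmxKV Au v) mulmx_sum_row; apply: memv_suml => b _.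
have [bk|kb] := leqP b k; last by rewrite vA// scale0r mem0v.
apply: memvZ; apply: memv_span; apply/mapP; exists b => //.
by rewrite mem_filter bk mem_enum.
Qed.
End Flags.

(** * Generators and second fundamental forms *)

Lemma val_idx_alpha n N (a : 'I_(N - n)) : idx_alpha a = (n.+1 + a)%N :> nat.
Proof. by rewrite /idx_alpha inordK// addSn ltnS; have := ltn_ord a; lia. Qed.

Lemma eq_entry_add (A : nmodType) m n (Y1 Z1 Y2 Z2 : 'M[A]_(m, n)) i j :
  Y1 + Z1 = Y2 + Z2 -> Y1 i j = 0 -> Y2 i j = 0 -> Z1 i j = Z2 i j.
Proof. by move=> /matrixP/(_ i j); rewrite !mxE => + Y10 Y20; rewrite Y10 Y20 !add0r. Qed.

Section Indices.
Variables (n r N : nat).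
Hypotheses (rn : (r < n)%N) (nN : (n <= N)%N).

Lemma val_idx_i (i : 'I_(n - r).+1) : idx_i N i = i :> nat.
Proof.
rewrite /idx_i inordK// ltnS; apply: leq_trans (_ : n - r <= N)%N.
  by rewrite -ltnS.
by apply: leq_trans nN; exact: leq_subr.
Qed.

Lemma val_idx_p (p : 'I_r) : idx_p n N p = ((n - r).+1 + p)%N :> nat.
Proof.
rewrite /idx_p inordK// addSn ltnS; apply: leq_trans nN.
have := ltn_ord p; lia.
Qed.

Lemma idx_i_inj : injective (@idx_i n r N).
Proof. by move=> i j /(congr1 val); rewrite /= !val_idx_i => /val_inj. Qed.

Lemma gt_idx_iF (i : 'I_(n - r).+1) (b : 'I_N.+1) :
  (n - r < b)%N -> (b == idx_i N i) = false.
Proof.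
by move=> lb; apply/negP => /eqP bE; move: lb; rewrite bE val_idx_i ltnNge -ltnS ltn_ord.
Qed.

Lemma sum_nat_inord (A : nmodType) (F : 'I_N.+1 -> A) :
  \sum_b F b = \sum_(0 <= k < N.+1) F (inord k).
Proof. by rewrite big_mkord; apply: eq_bigr => b _; rewrite inord_val. Qed.

Lemma sum_idx_i (A : nmodType) (F : 'I_N.+1 -> A) :
  (forall b : 'I_N.+1, (n - r < b)%N -> F b = 0) -> \sum_b F b = \sum_i F (@idx_i n r N i).
Proof.
move=> F0; rewrite sum_nat_inord (@big_cat_nat _ _ _ (n - r).+1)//=; last first.
  by rewrite ltnS; apply: leq_trans nN; exact: leq_subr.
rewrite big_mkord [X in _ + X]big_nat_cond [X in _ + X]big1 ?addr0// => k.
by rewrite andbT => /andP[k1 k2]; rewrite F0// inordK.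
Qed.

Lemma sum_idx_p (A : nmodType) (F : 'I_N.+1 -> A) :
  (forall b : 'I_N.+1, (n < b)%N -> F b = 0) -> (forall i, F (@idx_i n r N i) = 0) ->
  \sum_b F b = \sum_p F (@idx_p n r N p).
Proof.
move=> F0 Fi; rewrite sum_nat_inord (@big_cat_nat _ _ _ (n - r).+1)//=; last first.
  by rewrite ltnS; apply: leq_trans nN; exact: leq_subr.
rewrite big_mkord big1 ?add0r; last by move=> i _; exact: Fi.
have nE : n.+1 = (r + (n - r).+1)%N by lia.
rewrite (@big_cat_nat _ _ _ n.+1)//=; last by rewrite ltnS leq_subr.
rewrite [X in _ + X]big_nat_cond [X in _ + X]big1 ?addr0; last first.
  by move=> k; rewrite andbT => /andP[k1 k2]; rewrite F0// inordK.
rewrite nE -[X in index_iota X]add0n big_addn addnK big_mkord.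
by apply: eq_bigr => p _; rewrite /idx_p addnC.
Qed.

Lemma sum_mul_idx_i (A : pzRingType) (f g : 'I_N.+1 -> A) :
  (forall b : 'I_N.+1, (n - r < b)%N -> f b = 0) ->
  \sum_b f b * g b = \sum_i f (@idx_i n r N i) * g (@idx_i n r N i).
Proof. by move=> f0; apply: sum_idx_i => b /f0 ->; rewrite mul0r. Qed.

Lemma sum_mul_idx_p (A : pzRingType) (f g : 'I_N.+1 -> A) :
  (forall b : 'I_N.+1, (n < b)%N -> f b = 0) -> (forall i, g (@idx_i n r N i) = 0) ->
  \sum_b f b * g b = \sum_p f (@idx_p n r N p) * g (@idx_p n r N p).
Proof.
move=> f0 g0; apply: sum_idx_p => [b /f0 ->|i]; first by rewrite mul0r.
by rewrite g0 mulr0.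
Qed.

End Indices.

Section Generators.
Variables (R : realType) (n r N : nat) (X : degenerate_submanifold R n r N).
Hypothesis rn : (r < n)%N.
Local Notation C := (R[i] : numFieldType).
Local Notation V := (Cspace R r).
Local Notation idx_i := (@idx_i n r N).
Local Notation idx_p := (@idx_p n r N).
Local Notation idx_alpha := (@idx_alpha n N).

Lemma tangent_le_ambient : (n <= N)%N.
Proof.
have [u _] := manifold_nonempty (parameters X).
by have := dimvS (subvf (tangent u)); rewrite tangent_dim dimvf /dim /= mul1n ltnS.
Qed.
Let nN := tangent_le_ambient.

Lemma chart_invK_at (u : parameters X) (A : frame_at u) :
  chart_inv (frame_chart A) (frame_chart A u) = u.
Proof.
have [_ fw _ _ _] := atlas_chart (frame_atlas A).
by have [_ ->] := fw u (frame_chart_dom A).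
Qed.

Lemma generator_at (u : parameters X) (A : frame_at u) :
  generator u = flag (n - r) (A (frame_chart A u)).
Proof. by rewrite -(frame_generator (frame_base A)) chart_invK_at. Qed.

Lemma tangent_at (u : parameters X) (A : frame_at u) :
  tangent u = flag n (A (frame_chart A u)).
Proof. by rewrite -(frame_tangent (frame_base A)) chart_invK_at. Qed.

Lemma unit_at (u : parameters X) (A : frame_at u) : A (frame_chart A u) \in unitmx.
Proof. exact/frame_unit/frame_base. Qed.

Lemma row_dframe (u : parameters X) (A : frame_at u) a q b :
  (row a (dframe A q) *m invmx (A (frame_chart A u))) 0 b = omega A q a b.
Proof. by rewrite -row_mul mxE. Qed.

Lemma omega_i_alpha (u : parameters X) (A : frame_at u) q i (b : 'I_N.+1) :
  (n < b)%N -> omega A q (idx_i i) b = 0.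
Proof.
move=> nb; rewrite -row_dframe.
have : row (idx_i i) (dframe A q) \in tangent u.
  have /subvP := tangent_along A (delta_mx 0 i); apply.
  apply: (subvP (addvSr _ _)); apply: memv_span; apply/mapP; exists q.
    by rewrite mem_enum.
  rewrite (bigD1 i)//= big1 ?addr0 ?mxE ?eqxx ?scale1r// => j ji.
  by rewrite mxE (negbTE ji) andbF scale0r.
by rewrite (tangent_at A) => /(mem_flag _ _ (unit_at A)); apply.
Qed.

(** A row vector [z] killed by [D = sum_i x^i C_i] defines a linear form on the
    tangent subspace, the combination with coefficients [z] of the coordinates
    along the [A_p].  It vanishes on the generator and on the derivatives of
    [sum_i x^i A_i], which together span the tangent subspace at a generic [x],
    so it vanishes on each [A_p]. *)
Lemma generic_point_unit (u : parameters X) (A : frame_at u) :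
  exists x : 'rV[R[i]]_(n - r).+1, \sum_i x 0 i *: matC A i \in unitmx.
Proof.
have [x xE] := tangent_generic A; exists x.
set D := \sum_i _; apply: contraT => Du.
have [z zD z0] : exists2 z : 'rV_r, z *m D = 0 & z != 0.
  move: Du; rewrite -row_free_unit -kermx_eq0 => /rowV0Pn[z zk z0]; exists z => //.
  by apply/eqP; rewrite -sub_kermx.
pose sel : 'M[R[i]]_(N.+1, r) := \matrix_(b, p) (b == idx_p p)%:R.
pose Ai := invmx (A (frame_chart A u)).
pose f : {linear 'rV[R[i]]_N.+1 -> 'rV[R[i]]_1} := mulmxr (Ai *m (sel *m z^T)).
have fE v : f v 0 0 = \sum_p (v *m Ai) 0 (idx_p p) * z 0 p.
  rewrite /= !mulmxA mxE; apply: eq_bigr => p _; rewrite [z^T _ _]mxE; congr (_ * _).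
  rewrite mxE (bigD1 (idx_p p))//= big1; last by move=> b bp; rewrite !mxE (negbTE bp) mulr0.
  by rewrite !mxE eqxx mulr1 addr0.
have f0 v : (v \in lker (linfun f)) = (f v 0 0 == 0).
  rewrite memv_ker lfunE; apply/eqP/eqP => [->|f0]; first by rewrite mxE.
  by apply/rowP => j; rewrite ord1 f0 mxE.
have : (tangent u <= lker (linfun f))%VS.
  rewrite -xE subv_add; apply/andP; split.
    apply/subvP => v; rewrite (generator_at A) => /(mem_flag _ _ (unit_at A)) vA.
    rewrite f0 fE big1// => p _; rewrite vA ?mul0r//.
    by rewrite val_idx_p// addSn ltnS leq_addr.
  apply/span_subvP => _ /mapP[q _ ->]; rewrite f0 fE; apply/eqP.
  transitivity ((z *m D) 0 q); last by rewrite zD mxE.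
  rewrite mxE; apply: eq_bigr => p _; rewrite mulmx_suml !summxE mulrC; congr (_ * _).
  by apply: eq_bigr => i _; rewrite -scalemxAl mxE row_dframe !mxE.
rewrite (tangent_at A) => /subvP S.
suff zz : z = 0 by rewrite zz eqxx in z0.
apply/rowP => p; rewrite [RHS]mxE.
have := S (row (idx_p p) (A (frame_chart A u))).
have pE : row (idx_p p) (A (frame_chart A u)) *m Ai = delta_mx 0 (idx_p p).
  by rewrite -row_mul mulmxV ?unit_at// row1.
have -> : row (idx_p p) (A (frame_chart A u)) \in flag n (A (frame_chart A u)).
  apply/(mem_flag _ _ (unit_at A)) => b nb; rewrite -/Ai pE mxE /=.
  case: eqP => // bE; move: nb; rewrite bE val_idx_p//; have := ltn_ord p; lia.
move=> /(_ isT); rewrite f0 fE pE => /eqP.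
rewrite (bigD1 p)//= big1; last first.
  move=> q qp; rewrite mxE /= (_ : _ == _ = false) ?mul0r//.
  apply/negP => /eqP/(congr1 val); rewrite /= !val_idx_p// => /addnI/val_inj qpE.
  by rewrite qpE eqxx in qp.
by rewrite addr0 !mxE !eqxx mul1r.
Qed.

Lemma matCE (u : parameters X) (A : frame_at u) i p q :
  matC A i p q = omega A q (idx_i i) (idx_p p).
Proof. by rewrite [LHS]mxE. Qed.

Lemma matBE (u : parameters X) (A : frame_at u) a q p :
  matB A a q p = omega A q (idx_p p) (idx_alpha a).
Proof. by rewrite [LHS]mxE. Qed.

(** [omega_i^alpha = 0] near the base point, so the structure equation leaves
    [sum_p omega_i^p wedge omega_p^alpha = 0]. *)
Lemma second_form_sym (u : parameters X) (A : frame_at u) a i :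
  (matB A a *m matC A i)^T = matB A a *m matC A i.
Proof.
apply/matrixP => s q; rewrite [LHS]mxE.
have Aw := frame_base A; set w := frame_chart A u in Aw.
have zero (p : 'I_r) : \forall y \near w, omega_field A p y (idx_i i) (idx_alpha a) = 0.
  apply: filterS (near_frame_dom Aw) => y Ay; rewrite -(omega_rebase Ay).
  by apply: omega_i_alpha; rewrite val_idx_alpha// addSn ltnS leq_addr.
have dzero (p t : 'I_r) : derive_mx (dir R t) (omega_field A p) w (idx_i i) (idx_alpha a) = 0.
  rewrite mxE (near_eq_derive (g := cst (0 : C))) ?derive_cst//; exact: zero.
have entry (p t : 'I_r) : (omega_field A p w *m omega_field A t w) (idx_i i) (idx_alpha a) =
    \sum_k omega A p (idx_i i) (idx_p k) * omega A t (idx_p k) (idx_alpha a).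
  rewrite -!omegaE mxE; apply: (sum_mul_idx_p rn nN) => [b nb|j].
    exact: omega_i_alpha.
  by apply: omega_i_alpha; rewrite val_idx_alpha// addSn ltnS leq_addr.
have E := eq_entry_add (omega_integrable q s Aw) (dzero q s) (dzero s q).
have BC (p t : 'I_r) : (matB A a *m matC A i) p t =
    \sum_k omega A t (idx_i i) (idx_p k) * omega A p (idx_p k) (idx_alpha a).
  by rewrite [LHS]mxE; apply: eq_bigr => k _; rewrite matBE matCE mulrC.
exact: etrans (BC q s) (etrans (esym (entry s q)) (etrans (esym E)
  (etrans (entry q s) (esym (BC s q))))).
Qed.

Hypothesis r0 : (0 < r)%N.

(** Each [C_i] is a multiple of the generic combination [D]; not all factors
    vanish as [D] is invertible, and a [C_k] with nonzero factor can replace [D]. *)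
Lemma matC_proportional (u : parameters X) (A : frame_at u) :
  indecomposable (focus_equation A) -> ~ has_multiple_component (focus_equation A) ->
  exists (k : 'I_(n - r).+1) (l : 'I_(n - r).+1 -> R[i]),
    matC A k \in unitmx /\ forall i, matC A i = l i *: matC A k.
Proof.
move=> ind mult; have [x xu] := generic_point_unit A.
set D := \sum_i _ in xu.
have symD a : (matB A a *m D)^T = matB A a *m D.
  rewrite mulmx_sumr raddf_sum; apply: eq_bigr => i _ /=.
  by rewrite -scalemxAr linearZ /= second_form_sym.
have prop i : exists l, matC A i = l *: D.
  by apply: (irreducible_pencil_proportional r0 ind mult xu symD) => a; exact: second_form_sym.
pose l i := sval (cid (prop i)).
have lE i : matC A i = l i *: D by exact: svalP (cid (prop i)).
have [k lk] : exists k, l k != 0.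
  apply: contrapT => nk; have D0 : D = 0.
    rewrite /D big1// => i _; rewrite lE.
    have [->|li] := eqVneq (l i) 0; first by rewrite scale0r scaler0.
    by case: nk; exists i.
  by move: xu; rewrite D0 -(prednK r0) unitr0.
exists k, (fun i => l i / l k); split.
  by rewrite lE unitmxZ// unitfE.
by move=> i; rewrite [in RHS]lE scalerA divfK// lE.
Qed.
End Generators.

(** * The focus subspace of a generator *)

(** The relation says [nu wedge theta_p = 0] for the [r] independent forms with
    coefficients the rows of [D], and no nonzero form is a multiple of two
    independent ones. *)
Lemma wedge_unit_eq0 (F : fieldType) r (D : 'M[F]_r) (nu : 'I_r -> F) :
  (1 < r)%N -> D \in unitmx -> (forall p q s, nu q * D p s = nu s * D p q) ->
  forall q, nu q = 0.
Proof.
move=> r1 Du H q.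
have [s sq] : exists s : 'I_r, s != q.
  have : (0 < #|predC1 q|)%N by rewrite cardC1 card_ord; case: (r) r1 => // -[].
  by move=> /card_gt0P[s]; exists s.
pose v : 'cV[F]_r := nu q *: delta_mx s 0 - nu s *: delta_mx q 0.
have Dv : D *m v = 0.
  rewrite mulmxBr -!scalemxAr -!colE; apply/colP => p; rewrite !mxE.
  by rewrite H subrr.
have : v = 0 by rewrite -(mulKmx Du v) Dv mulmx0.
move=> /colP/(_ s); rewrite !mxE !eqxx andbT (negbTE sq) /= mulr1 mulr0 subr0.
by [].
Qed.

Section VertexRows.
Variables (F : fieldType) (n r N : nat).
Hypothesis (nN : (n <= N)%N).
Variable (k : 'I_(n - r).+1).
Local Notation idx_i := (@idx_i n r N).

(** The coordinates in a frame [A] of the points [A_i - lam_i A_k], where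
    [i = lift k j] runs over the indices other than [k]. *)
Definition vertex_rows (lam : 'I_(n - r).+1 -> F) : 'M[F]_(n - r, N.+1) :=
  \matrix_(j, b) ((b == idx_i (lift k j))%:R - lam (lift k j) * (b == idx_i k)%:R).

Definition vertex_cols : 'M[F]_(N.+1, n - r) := \matrix_(b, j) (b == idx_i (lift k j))%:R.

Lemma mul_vertex_rows (lam : 'I_(n - r).+1 -> F) m (Z : 'M[F]_(N.+1, m)) j t :
  (vertex_rows lam *m Z) j t = Z (idx_i (lift k j)) t - lam (lift k j) * Z (idx_i k) t.
Proof.
rewrite mxE.
under eq_bigr do rewrite mxE mulrBl -mulrA.
rewrite sumrB -mulr_sumr; congr (_ - _ * _).
  by rewrite (bigD1 (idx_i (lift k j)))//= eqxx mul1r big1 ?addr0// => b /negbTE ->; rewrite mul0r.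
by rewrite (bigD1 (idx_i k))//= eqxx mul1r big1 ?addr0// => b /negbTE ->; rewrite mul0r.
Qed.

Lemma mul_vertex_cols m (G : 'M[F]_(m, N.+1)) i j :
  (G *m vertex_cols) i j = G i (idx_i (lift k j)).
Proof.
rewrite mxE (bigD1 (idx_i (lift k j)))//= big1.
  by rewrite mxE eqxx mulr1 addr0.
by move=> b /negbTE bE; rewrite mxE bE mulr0.
Qed.

Lemma idx_i_eq (i i' : 'I_(n - r).+1) : (idx_i i == idx_i i') = (i == i').
Proof. by rewrite (inj_eq (@idx_i_inj n r N nN)). Qed.

Lemma vertex_rows_cols lam : vertex_rows lam *m vertex_cols = 1%:M.
Proof.
apply/matrixP => j j'; rewrite mul_vertex_cols !mxE !idx_i_eq.
by rewrite (inj_eq lift_inj) eq_sym [_ == k]eq_sym (negbTE (neq_lift _ _)) mulr0 subr0.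
Qed.

(** In the basis formed by [A_k] and the [A_i - lam_i A_k] with [i != k] of the
    span of the [A_i], the coefficient on [A_k] of a row [g] is
    [sum_i g_i lam_i]. *)
Lemma vertex_rowsE lam m (G : 'M[F]_(m, N.+1)) :
  lam k = 1 ->
  (forall j (b : 'I_N.+1), (n - r < b)%N -> G j b = 0) ->
  (forall j, \sum_i G j (idx_i i) * lam i = 0) ->
  G = (G *m vertex_cols) *m vertex_rows lam.
Proof.
move=> lk G0 nu; apply/matrixP => j b; rewrite [RHS]mxE.
under eq_bigr do rewrite mul_vertex_cols mxE mulrBr.
have [lb|bl] := ltnP (n - r) b.
  rewrite G0// big1// => t _.
  by rewrite !(gt_idx_iF nN _ lb) !mulr0 subr0.
have [i ->] : exists i, b = idx_i i.
  by exists (Ordinal (bl : b < (n - r).+1)%N); apply: val_inj; rewrite /= val_idx_i.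
under eq_bigr do rewrite !idx_i_eq.
case: (unliftP k i) => [t ->|->].
  rewrite (bigD1 t)//= eqxx eq_sym (negbTE (neq_lift _ _)) !mulr0 subr0 mulr1 big1 ?addr0// => t' tt'.
  by rewrite (inj_eq lift_inj) eq_sym (negbTE tt') !mulr0 subr0.
have := nu j; rewrite (bigD1_ord k)//= lk mulr1 => /eqP.
rewrite addr_eq0 => /eqP ->; rewrite -sumrN; apply: eq_bigr => t _.
by rewrite (negbTE (neq_lift _ _)) eqxx mulr0 mulr1 sub0r.
Qed.
End VertexRows.

(** When [A1], [A2] and [D1], [D2] are derivatives of [W] and of connection
    matrices [O2], [O1], this expresses the symmetry of the second derivatives of
    [W A], where [dA = O A]. *)
Lemma flat_exchange (F : pzRingType) l m (A1 A2 W : 'M[F]_(l, m)) (O1 O2 D1 D2 : 'M[F]_m) :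
  D2 + O1 *m O2 = D1 + O2 *m O1 ->
  (A2 *m O1 + W *m D2) + (A1 + W *m O1) *m O2 =
  (A1 *m O2 + W *m D1) + (A2 + W *m O2) *m O1.
Proof.
move=> E; rewrite !mulmxDl -!mulmxA [LHS]addrACA [RHS]addrACA -!mulmxDr.
by rewrite E (addrC (A2 *m O1)).
Qed.

Section VertexField.
Variables (R : realType) (n r N : nat).
Hypotheses (r1 : (1 < r)%N) (rn : (r < n)%N) (nN : (n <= N)%N).
Local Notation C := (R[i] : numFieldType).
Local Notation V := (Cspace R r).
Local Notation idx_i := (@idx_i n r N).
Local Notation idx_p := (@idx_p n r N).
Variables (k : 'I_(n - r).+1) (Om : 'I_r -> V -> 'M[C]_N.+1).
Variables (lam : 'I_(n - r).+1 -> V -> C) (y : V).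
Local Notation W := (fun z => vertex_rows N k (lam ^~ z)).

Lemma mx_differentiable_vertex_rows :
  (forall i, differentiable (lam i) y) -> mx_differentiable W y.
Proof.
move=> dl j b; under eq_fun do rewrite mxE.
apply: differentiableB; first exact: differentiable_cst.
by apply: differentiableM; [exact: dl|exact: differentiable_cst].
Qed.

Lemma derive_vertex_rows0 v j (b : 'I_N.+1) :
  (n - r < b)%N -> derive_mx v W y j b = 0.
Proof.
move=> lb; rewrite [LHS]mxE; under eq_fun do rewrite mxE.
under eq_fun do rewrite !(gt_idx_iF nN _ lb) mulr0 subr0.
exact: derive_cst.
Qed.

(** [G_q = D_q W + W Om_q] are the coefficients of the derivative of [W A].  It
    has coordinates along the [A_i] only.  Let [nu_q] be its coefficient on [A_k]
    modulo the rows of [W]; then [nu_q] times column [s] of [C_k] equals [nu_s]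
    times column [q], which is [flat_exchange] on the columns of the [A_p], where
    [W Om] vanishes identically. *)
Lemma vertex_rows_closed q :
  (forall i, differentiable (lam i) y) ->
  (forall p, mx_differentiable (Om p) y) ->
  (forall p s, derive_mx (dir R s) (Om p) y + Om p y *m Om s y =
               derive_mx (dir R p) (Om s) y + Om s y *m Om p y) ->
  (\forall z \near y, forall s i p,
     Om s z (idx_i i) (idx_p p) = lam i z * Om s z (idx_i k) (idx_p p)) ->
  (forall s i (b : 'I_N.+1), (n < b)%N -> Om s y (idx_i i) b = 0) ->
  (\matrix_(p, s) Om s y (idx_i k) (idx_p p) : 'M[C]_r) \in unitmx ->
  lam k y = 1 ->
  exists mu, derive_mx (dir R q) W y + W y *m Om q y = mu *m W y.
Proof.
move=> dl dOm mc prop0 alpha0 Cu lk.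
pose G q := derive_mx (dir R q) W y + W y *m Om q y.
have dW := mx_differentiable_vertex_rows dl.
have WOm0 : \forall z \near y, forall s j p, (W z *m Om s z) j (idx_p p) = 0.
  by apply: filterS prop0 => z H s j p; rewrite mul_vertex_rows (H s (lift k j)) subrr.
have G0 s j (b : 'I_N.+1) : (n - r < b)%N -> G s j b = 0.
  move=> lb; rewrite [LHS]mxE derive_vertex_rows0// add0r.
  have [nb|bn] := ltnP n b; first by rewrite mul_vertex_rows !alpha0// mulr0 subr0.
  have br : (b - (n - r).+1 < r)%N by lia.
  have -> : b = idx_p (Ordinal br) by apply: val_inj; rewrite /= val_idx_p//=; lia.
  exact: (nbhs_singleton WOm0).
have D0 (a b : 'I_r) j p :
    (derive_mx (dir R a) W y *m Om b y + W y *m derive_mx (dir R a) (Om b) y) j (idx_p p) = 0.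
  have <- : derive_mx (dir R a) (fun z => W z *m Om b z) y j (idx_p p) = 0.
    rewrite [LHS]mxE (near_eq_derive (g := cst (0 : C))); first exact: derive_cst.
    by apply: filterS WOm0 => z; exact.
  by have -> := derive_mx_mul (dir R a) dW (dOm b).
have GOm a b j p : (G a *m Om b y) j (idx_p p) = (G b *m Om a y) j (idx_p p).
  exact: eq_entry_add (flat_exchange _ _ _ (mc a b)) (D0 b a j p) (D0 a b j p).
exists (G q *m vertex_cols C N k); apply: vertex_rowsE => //.
- by move=> j b; exact: G0.
move=> j.
pose nu s := \sum_i G s j (idx_i i) * lam i y.
apply: (wedge_unit_eq0 r1 Cu (nu := nu)) => p q' s.
have GE s' t : (G s' *m Om t y) j (idx_p p) = nu s' * Om t y (idx_i k) (idx_p p).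
  rewrite [LHS]mxE (@sum_mul_idx_i n r N nN); last by move=> b; exact: G0.
  rewrite mulr_suml; apply: eq_bigr => i _.
  by rewrite (nbhs_singleton prop0 t i p); exact: mulrA.
by rewrite ![(\matrix_(_, _) _) _ _]mxE -!GE; exact: GOm.
Qed.
End VertexField.

Section Vertex.
Variables (R : realType) (n r N : nat) (X : degenerate_submanifold R n r N).
Hypotheses (r1 : (1 < r)%N) (rn : (r < n)%N).
Hypothesis ind : forall (u : parameters X) (A : frame_at u), indecomposable (focus_equation A).
Hypothesis red : forall (u : parameters X) (A : frame_at u),
  ~ has_multiple_component (focus_equation A).
Local Notation C := (R[i] : numFieldType).
Local Notation V := (Cspace R r).
Local Notation idx_i := (@idx_i n r N).
Local Notation idx_p := (@idx_p n r N).
Let r0 : (0 < r)%N := ltnW r1.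
Let nN : (n <= N)%N := tangent_le_ambient X.

Section Chart.
Variables (u0 : parameters X) (A : frame_at u0).
Local Notation w0 := (frame_chart A u0).

Lemma matC_rebase y (Ay : frame_dom A y) i p q :
  matC (rebase Ay) i p q = omega_field A q y (idx_i i) (idx_p p).
Proof. by rewrite matCE omega_rebase. Qed.

(** Proportionality of the [C_i] is a pointwise statement; the factors become
    differentiable functions as quotients of two fixed entries, the denominator
    being nonzero near the base point. *)
Lemma pivot_coefficients : exists (k : 'I_(n - r).+1) (lam : 'I_(n - r).+1 -> V -> C),
  \forall y \near w0, [/\ frame_dom A y, forall i, differentiable (lam i) y, lam k y = 1,
    (\matrix_(p, s) omega_field A s y (idx_i k) (idx_p p) : 'M[C]_r) \in unitmx &
    forall s i p, omega_field A s y (idx_i i) (idx_p p) =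
                  lam i y * omega_field A s y (idx_i k) (idx_p p)].
Proof.
have [k [_ [Cu _]]] := matC_proportional rn r0 (ind A) (@red _ A).
pose f p q i y : C := omega_field A q y (idx_i i) (idx_p p).
have [p0 [q0 f0]] : exists p0 q0, f p0 q0 k w0 != 0.
  apply: contrapT => nf; suff C0 : matC A k = 0.
    by move: Cu; rewrite C0 -(prednK r0) unitr0.
  apply/matrixP => p q; rewrite matCE omegaE [RHS]mxE.
  by apply: contrapT => /eqP fn; apply: nf; exists p, q.
pose lam i (y : V) : C := f p0 q0 i y * (f p0 q0 k y)^-1.
exists k, lam.
have df y i : frame_dom A y -> differentiable (f p0 q0 i) y.
  by move=> Ay; apply: mx_differentiable_omega.
have nf : \forall y \near w0, f p0 q0 k y != 0.
  have c : (f p0 q0 k y : C) @[y --> w0] --> (f p0 q0 k w0 : C).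
    by apply: differentiable_continuous; apply: df; exact: frame_base.
  exact: (cvgr_neq0 _ c f0).
apply: filterS2 (near_frame_dom (frame_base A)) nf => y Ay fy.
have [k' [l [Cu' Cl]]] := matC_proportional rn r0 (ind (rebase Ay)) (@red _ (rebase Ay)).
have fE p q i : f p q i y = l i * matC (rebase Ay) k' p q.
  by rewrite /f -matC_rebase Cl mxE.
have lk : l k != 0 by apply: contraNneq fy => lk0; rewrite fE lk0 mul0r.
have ck : matC (rebase Ay) k' p0 q0 != 0 by apply: contraNneq fy => ck0; rewrite fE ck0 mulr0.
have lamE i : lam i y = l i / l k.
  by rewrite /lam !fE invfM mulrACA divff// mulr1.
split; first exact: Ay.
- move=> i; apply: differentiableM; first exact: df.
  by apply: differentiableV; [exact: df|exact: fy].
- by rewrite lamE divff.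
- have -> : (\matrix_(p, s) omega_field A s y (idx_i k) (idx_p p) : 'M[C]_r) = matC (rebase Ay) k.
    by apply/matrixP => p s; rewrite [LHS]mxE matC_rebase.
  by rewrite Cl unitmxZ// unitfE.
- move=> s i p; rewrite -/(f p s i y) -/(f p s k y) !fE lamE.
  by rewrite mulrA divfK.
Qed.

(** The rows of [Y0] are the points [A_i - lam_i A_k] at the base point; their
    span lies in the generators of all nearby parameters. *)
Lemma constant_vertex_rows : exists Y0 : 'M[R[i]]_(n - r, N.+1),
  row_free Y0 /\ \forall y \near w0, frame_dom A y /\
    forall j (b : 'I_N.+1), (n - r < b)%N -> (Y0 *m invmx (frame_mx A y)) j b = 0.
Proof.
have [k [lam piv]] := pivot_coefficients.
pose W z : 'M[C]_(n - r, N.+1) := vertex_rows N k (lam ^~ z).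
pose Y z := W z *m (frame_mx A z : 'M[C]_N.+1).
pose T : 'M[C]_(N.+1, n - r) := invmx (frame_mx A w0 : 'M[C]_N.+1) *m vertex_cols C N k.
have YT : Y w0 *m T = 1%:M.
  by rewrite /Y /T mulmxA mulmxK ?unit_at// vertex_rows_cols.
have nY : \forall y \near w0, mx_differentiable Y y /\
    forall q, exists mu, derive_mx (dir R q) Y y = mu *m Y y.
  apply: filterS (nbhs_interior piv) => y py.
  have [Ay dl lk Cu prop] := nbhs_singleton py.
  have dA : mx_differentiable (frame_mx A : V -> 'M[C]_N.+1) y.
    by apply: differentiable_entries; exact: differentiable_frame.
  have dW : mx_differentiable W y by exact: mx_differentiable_vertex_rows.
  split=> [|q]; first exact: mx_differentiable_mul.
  have [mu muE] : exists mu, derive_mx (dir R q) W y + W y *m omega_field A q y = mu *m W y.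
    have dOm p : mx_differentiable (omega_field A p) y by exact: mx_differentiable_omega.
    have mc p s := omega_integrable p s Ay.
    have prop0 : \forall z \near y, forall s i p, omega_field A s z (idx_i i) (idx_p p) =
        lam i z * omega_field A s z (idx_i k) (idx_p p).
      by apply: filterS py => z [].
    have alpha0 s i (b : 'I_N.+1) : (n < b)%N -> omega_field A s y (idx_i i) b = 0.
      by move=> nb; rewrite -(omega_rebase Ay); exact: omega_i_alpha.
    exact: (vertex_rows_closed r1 rn nN q dl dOm mc prop0 alpha0 Cu lk).
  exists mu; rewrite /Y mulmxA -muE mulmxDl -mulmxA -derive_frame//.
  rewrite derive_entries; last exact: differentiable_frame.
  exact: derive_mx_mul.
exists (Y w0); split; first by apply/row_freeP; exists T.
apply: filterS2 (near_frame_dom (frame_base A)) (row_space_locally_constant YT nY).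
move=> y Ay /submxP[D ->]; split=> // j b lb.
rewrite /Y mulmxA mulmxK; last exact: frame_unit.
rewrite [LHS]mxE big1// => t _; rewrite [W _ _ _]mxE.
by rewrite !(gt_idx_iF nN _ lb) mulr0 subr0 mulr0.
Qed.
End Chart.

(** * Gluing the local vertices *)

Lemma near_chart (u0 : parameters X) (A : frame_at u0) (P : V -> Prop) :
  (\forall w \near frame_chart A u0, P w) ->
  \forall u \near u0, chart_dom (frame_chart A) u /\ P (frame_chart A u).
Proof.
have [[od _] _ _ cc _] := atlas_chart (frame_atlas A); move=> nP.
have du := frame_chart_dom A.
have nd : \forall u \near u0, chart_dom (frame_chart A) u.
  by apply: open_nbhs_nbhs; split.
move: cc; rewrite (continuous_open_subspace _ od) => /(_ u0 (mem_set du))/(_ _ nP) nP'.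
by apply: filterS2 nd nP'.
Qed.

Lemma near_chart_inv (u0 : parameters X) (A : frame_at u0) (P : parameters X -> Prop) :
  (\forall u \near u0, P u) ->
  \forall w \near frame_chart A u0, P (chart_inv (frame_chart A) w).
Proof.
have [[_ oc] fw _ _ ci] := atlas_chart (frame_atlas A); move=> nP.
have [cw cK] := fw u0 (frame_chart_dom A).
move: ci; rewrite (continuous_open_subspace _ oc) => /(_ _ (mem_set cw)); rewrite /continuous_at cK.
by move=> /(_ _ nP).
Qed.

Lemma local_vertex (u0 : parameters X) : exists S : {vspace 'rV[R[i]]_N.+1},
  \dim S = (n - r)%N /\ \forall u \near u0, (S <= generator u)%VS.
Proof.
have [A] := has_frame u0.
have [Y0 [fY nY]] := constant_vertex_rows A.
pose f : 'Hom('rV[R[i]]_(n - r), 'rV[R[i]]_N.+1) := linfun (mulmxr Y0).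
exists (limg f); split.
  rewrite limg_dim_eq; first by rewrite dimvf /dim /= mul1n.
  rewrite capfv; apply/eqP; rewrite -subv0; apply/subvP => z.
  rewrite memv_ker lfunE /= memv0 => /eqP zY.
  by apply/eqP; apply: (row_free_inj fY); rewrite zY mul0mx.
apply: filterS (near_chart nY) => u [du [Au Y0A]].
have [_ fw _ _ _] := atlas_chart (frame_atlas A).
have [_ cK] := fw u du.
apply/subvP => _ /memv_imgP[z _ ->]; rewrite lfunE /=.
rewrite -[u in generator u]cK (frame_generator Au).
apply/mem_flag => [|b lb]; first exact: frame_unit.
rewrite -mulmxA [LHS]mxE big1// => j _.
by rewrite Y0A ?mulr0.
Qed.

(** For a constant generator the derivatives of the [A_i] would stay in it,
    making all the [C_i] zero. *)
Lemma generator_not_constant (u0 : parameters X) (L0 : {vspace 'rV[R[i]]_N.+1}) :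
  ~ \forall u \near u0, generator u = L0.
Proof.
move=> nL; have [A] := has_frame u0; set w0 := frame_chart A u0.
have [x] := generic_point_unit rn A.
suff C0 i : matC A i = 0.
  by under eq_bigr do rewrite C0 scaler0; rewrite big1// -(prednK r0) unitr0.
pose B := invmx (frame_mx A w0 : 'M[C]_N.+1).
have zero j (b : 'I_N.+1) : (n - r < b)%N ->
    \forall w \near w0, ((frame_mx A w : 'M[C]_N.+1) *m B) (idx_i j) b = 0.
  move=> lb; apply: filterS2 (near_frame_dom (frame_base A)) (@near_chart_inv _ A _ nL).
  move=> w Aw Lw.
  have : row (idx_i j) (frame_mx A w) \in flag (n - r) (frame_mx A w0).
    rewrite -(generator_at A) (nbhs_singleton nL) -Lw (frame_generator Aw).
    apply/mem_flag => [|c lc]; first exact: frame_unit.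
    rewrite -row_mul mulmxV; last exact: frame_unit.
    rewrite !mxE; case: eqP => // cE.
    by move: lc; rewrite -cE val_idx_i// ltnNge -ltnS ltn_ord.
  move=> /(mem_flag _ _ (unit_at A))/(_ b lb).
  by rewrite -row_mul mxE.
apply/matrixP => p q; rewrite matCE [RHS]mxE /omega /dframe -/w0.
have dA : mx_differentiable (frame_mx A : V -> 'M[C]_N.+1) w0.
  by apply: differentiable_entries; apply: differentiable_frame; exact: frame_base.
have dB : mx_differentiable (fun _ : V => B) w0 by exact: mx_differentiable_cst.
have lp : (n - r < idx_p p)%N by rewrite val_idx_p// addSn ltnS leq_addr.
have : derive_mx (dir R q) (fun w => (frame_mx A w : 'M[C]_N.+1) *m B) w0 (idx_i i) (idx_p p) = 0.
  rewrite [LHS]mxE (near_eq_derive (g := cst (0 : C))); first exact: derive_cst.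
  exact: zero.
have -> := derive_mx_mul (dir R q) dA dB.
rewrite derive_mx_cst mulmx0 addr0 -derive_entries//.
by apply: differentiable_frame; exact: frame_base.
Qed.

(** Two different subspaces of codimension one in the generator have it as their
    sum. *)
Lemma local_vertex_unique (u0 : parameters X) (S1 S2 : {vspace 'rV[R[i]]_N.+1}) :
  \dim S1 = (n - r)%N -> \dim S2 = (n - r)%N ->
  (\forall u \near u0, (S1 <= generator u)%VS) ->
  (\forall u \near u0, (S2 <= generator u)%VS) -> S1 = S2.
Proof.
move=> d1 d2 n1 n2.
have [le|gt] := leqP (\dim (S1 + S2)) (n - r).
  have /eqP E1 : S1 == (S1 + S2)%VS by rewrite eqEdim addvSl d1.
  have /eqP E2 : S2 == (S1 + S2)%VS by rewrite eqEdim addvSr d2.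
  by rewrite E1 -E2.
case: (@generator_not_constant u0 (S1 + S2)%VS).
apply: filterS2 n1 n2 => u s1 s2; apply/esym/eqP.
by rewrite eqEdim subv_add s1 s2 generator_dim.
Qed.

(** The set of parameters near which a given local vertex lies in the generators
    is open by definition and closed by the uniqueness of local vertices. *)
Lemma global_vertex : is_cone X.
Proof.
have [u1 _] := manifold_nonempty (parameters X).
have [S [dS nS]] := local_vertex u1.
pose B := [set u : parameters X | \forall u' \near u, (S <= generator u')%VS].
have BT : B = setT.
  apply: (@manifold_connected _ _ (parameters X)).
  - by exists u1.
  - exists B; last by rewrite setTI.
    rewrite openE => u Bu; exact: nbhs_interior.
  - exists B; last by rewrite setTI.
    move=> u /= clu; have [S' [dS' nS']] := local_vertex u.
    have [u' [Bu' nSu']] := clu _ (nbhs_interior nS').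
    by rewrite /B /= (local_vertex_unique dS dS' Bu' nSu').
exists S; split=> // u.
have : B u by rewrite BT.
exact: nbhs_singleton.
Qed.
End Vertex.

Theorem theorem4 (R : realType) (n r N m : nat)
  (hr : (2 <= r)%N) (hrn : (r < n)%N)
  (X : degenerate_submanifold R n r N)
  (hreg : forall u : parameters X, regular_system u)
  (hforms : forall (u : parameters X) (A : frame_at u), number_of_forms A = m)
  (hm : (2 <= m)%N)
  (hmult : forall (u : parameters X) (A : frame_at u),
     ~ has_multiple_component (focus_equation A))
  (hind : forall (u : parameters X) (A : frame_at u),
     indecomposable (focus_equation A)) :
  is_cone X.
Proof. exact: global_vertex hr hrn hind hmult. Qed.
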